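(* Fix $\lambda\in(0,\tfrac1{16})$, $\nu=\sqrt{1-16\lambda}$, $t_1=\frac{1-\nu}{4\lambda}$, $t_2=\frac{1+\nu}{4\lambda}$, an integer $l\ge2$, $\ell=(l-1)(l+2)$, $t_i\in(0,t_1)$, and let $G(t)=\tfrac12-\lambda t$, $\alpha(t)=-2t(1-tG(t))$, $\beta(t)=1-2tG(t)$, $\gamma(t)=2G(t)$. Let $\kappa\in[0,\kappa_1)$ with $\kappa_1=\frac{1+32\lambda-32\lambda^2-\nu}{16\lambda}$. Let $f,g,\mu_0\in C_0^\infty(\mathbb{R})$ and let $\phi\in C^\infty([t_i,t_1)\times\mathbb{R})$ be the solution of $$\alpha\phi_{,tt}+2\beta\phi_{,tx}+\gamma\phi_{,xx}+(\alpha'+(6-2\kappa)\beta)\phi_{,t}+(\beta'+(6-2\kappa)\gamma)\phi_{,x}+\big((4-\kappa)\beta'+(8-6\kappa+\kappa^2)\gamma-\ell\big)\phi=8\lambda e^{(\kappa-3)x}\mu_0(te^x)$$ with $\phi(t_i,\cdot)=f$, $\phi_{,t}(t_i,\cdot)=g$. Then $\phi$ is uniformly bounded on $[t_i,t_1)\times\mathbb{R}$: there exist positive constants $C_1,C_2$ (independent of $f,g,\mu_0$) such that $$|\phi(t,x)|^2\le C_1E_1[\phi](0)+C_2J_\kappa[\mu_0],\quad t\in[t_i,t_1),\ x\in\mathbb{R},$$ where $E_1[\phi](0)=\int_{\mathbb{R}}\big(\phi^2+(\alpha\phi_{,t}+\beta\phi_{,x})^2+\phi_{,x}^2\big)\big|_{t=t_i}dx$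 and $J_\kappa[\mu_0]=\int_{\mathbb{R}}e^{2(\kappa-3)x}\mu_0(t_ie^x)^2dx$.
   Context: Primes denote $d/dt$. *)

(* Defs.v *)
From Stdlib Require Import Reals.
From Coquelicot Require Import Coquelicot.
Open Scope R_scope.

Definition nu (lam : R) : R := sqrt (1 - 16 * lam).
Definition t1 (lam : R) : R := (1 - nu lam) / (4 * lam).
Definition t2 (lam : R) : R := (1 + nu lam) / (4 * lam).
Definition Gf (lam t : R) : R := 1/2 - lam * t.
Definition alphaf (lam t : R) : R := -2 * t * (1 - t * Gf lam t).
Definition betaf (lam t : R) : R := 1 - 2 * t * Gf lam t.
Definition gammaf (lam t : R) : R := 2 * Gf lam t.
Definition kappa1 (lam : R) : R :=
  (1 + 32 * lam - 32 * lam ^ 2 - nu lam) / (16 * lam).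
Definition ellf (l : nat) : R := (INR l - 1) * (INR l + 2).

Definition smooth1 (f : R -> R) : Prop := forall n x, ex_derive_n f n x.
Definition compact_support (f : R -> R) : Prop :=
  exists M, forall x, M < Rabs x -> f x = 0.
Definition C0inf (f : R -> R) : Prop := smooth1 f /\ compact_support f.

Definition is_derive_within (P : R -> Prop) (f : R -> R) (t l : R) : Prop :=
  filterlim (fun s => (f s - f t) / (s - t))
    (within (fun s => P s /\ s <> t) (locally t)) (locally l).

(* phi in C^infty([ti,t1) x R), with D n m = d_t^n d_x^m phi on the strip. *)
Definition smooth_strip (ti tf : R) (phi : R -> R -> R)
    (D : nat -> nat -> R -> R -> R) : Prop :=
  forall n m t x, ti <= t < tf ->
    D 0%nat 0%nat t x = phi t x /\
    is_derive_within (fun s => ti <= s < tf) (fun s => D n m s x) t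
      (D (S n) m t x) /\
    is_derive (fun y => D n m t y) x (D n (S m) t x) /\
    filterlim (fun p : R * R => D n m (fst p) (snd p))
      (within (fun p : R * R => ti <= fst p < tf) (locally (t, x)))
      (locally (D n m t x)).

(* Improper integral over R of a nonnegative continuous function,
   as an extended real (possibly p_infty). *)
Definition int_R (h : R -> R) : Rbar :=
  Lim_seq (fun n => RInt h (- INR n) (INR n)).

Definition E1_0 (lam ti : R) (D : nat -> nat -> R -> R -> R) : Rbar :=
  int_R (fun x => (D 0%nat 0%nat ti x) ^ 2
     + (alphaf lam ti * D 1%nat 0%nat ti x + betaf lam ti * D 0%nat 1%nat ti x) ^ 2
     + (D 0%nat 1%nat ti x) ^ 2).

Definition J_kappa (kappa ti : R) (mu0 : R -> R) : Rbar :=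
  int_R (fun x => exp (2 * (kappa - 3) * x) * (mu0 (ti * exp x)) ^ 2).

(* Main.v *)
Require Import Defs.
From Stdlib Require Import Reals Lra.
From Coquelicot Require Import Coquelicot.
Open Scope R_scope.

(** Write [c = 6 - 2 kappa] (positive, because [kappa1 < 3]), [b = G / (1 - t G)], which blows up
    like [1 / (t1 - t)], and [psi = alpha phi_t + beta phi_x]. Since [beta^2 - alpha gamma = 1], the
    equation is diagonal in [p = psi + phi_x] and [q = psi - phi_x], which travel with speeds [b] and
    [- 1 / t]. In the equation of [p] the singular coefficient is a damping [- (c / 2) b p]; in that
    of [q] it disappears when [q] is replaced by [r = q - c phi]; and [phi] itself satisfies
    [phi_t - phi_x / t = - (b + 1 / t) p / 2]. Weighting [p^2] by [(t1 - t)^(- delta)] with a small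
    [delta > 0], the damping absorbs the singular cross terms up to coefficients that are integrable
    in time up to [t1], so Gronwall's argument bounds the [L^2] norms of [p], [r] and [phi], hence of
    [phi] and [phi_x], uniformly; a one-dimensional Sobolev inequality concludes. All integrals are
    taken over truncated backward cones, so no decay in [x] is needed. *)

(** * Integrals of nonnegative functions and a one-dimensional Sobolev inequality *)

Lemma continuous_is_derive (f : R -> R) (x l : R) :
  is_derive f x l -> continuous f x.
Proof. intros H. apply (ex_derive_continuous (V := R_NormedModule)). exists l. exact H. Qed.

Lemma continuous_pow2 (f : R -> R) (x : R) :
  continuous f x -> continuous (fun y => f y ^ 2) x.
Proof.
  intros Hf. apply (continuous_comp f (fun z => z ^ 2)); [exact Hf|].
  apply (ex_derive_continuous (V := R_NormedModule)). auto_derive. exact I.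
Qed.

Lemma ex_RInt_everywhere_continuous (f : R -> R) (a b : R) :
  (forall x, continuous f x) -> ex_RInt f a b.
Proof. intros H. apply (ex_RInt_continuous (V := R_CompleteNormedModule)). intros; apply H. Qed.

Lemma RInt_subinterval_le (f : R -> R) (a a' b' b : R) :
  (forall x, continuous f x) -> (forall x, 0 <= f x) ->
  a <= a' -> a' <= b' -> b' <= b -> RInt f a' b' <= RInt f a b.
Proof.
  intros Hc Hp H1 H2 H3.
  assert (E : forall u v, ex_RInt f u v) by (intros; apply ex_RInt_everywhere_continuous, Hc).
  assert (P : forall u v, u <= v -> 0 <= RInt f u v).
  { intros u v Huv. apply RInt_ge_0; auto. }
  rewrite <- (RInt_Chasles f a a' b) by apply E.
  rewrite <- (RInt_Chasles f a' b' b) by apply E.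
  unfold plus; simpl.
  pose proof (P a a' H1). pose proof (P b' b H3). lra.
Qed.

Lemma RInt_le_int_R (h : R -> R) (a b : R) :
  (forall x, continuous h x) -> (forall x, 0 <= h x) -> a <= b ->
  Rbar_le (RInt h a b) (int_R h).
Proof.
  intros Hc Hp Hab. unfold int_R.
  rewrite <- (Lim_seq_const (RInt h a b)).
  apply Lim_seq_le_loc.
  (* [S N] exceeds [Rabs a + Rabs b], so [[- n, n]] contains [[a, b]] from the index [S N] on. *)
  destruct (nfloor_ex (Rabs a + Rabs b)) as [N HN].
  { pose proof (Rabs_pos a). pose proof (Rabs_pos b). lra. }
  exists (S N). intros n Hn.
  apply le_INR in Hn. rewrite S_INR in Hn.
  apply RInt_subinterval_le; auto;
    revert HN; unfold Rabs; destruct (Rcase_abs a), (Rcase_abs b); lra.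
Qed.

Lemma int_R_nonneg (h : R -> R) :
  (forall x, continuous h x) -> (forall x, 0 <= h x) -> Rbar_le 0 (int_R h).
Proof.
  intros Hc Hp.
  apply Rbar_le_trans with (RInt h 0 0).
  - rewrite (RInt_point 0 h). apply Rle_refl.
  - apply RInt_le_int_R; auto; lra.
Qed.

(* Integrate the derivative of [(y - x + 1) (f y)^2] over [x - 1, x]. *)
Lemma sobolev_unit_interval (f df : R -> R) (x : R) :
  (forall y, is_derive f y (df y)) -> (forall y, continuous df y) ->
  f x ^ 2 <= RInt (fun y => 2 * f y ^ 2 + df y ^ 2) (x - 1) (x + 1).
Proof.
  intros Hf Hdf.
  assert (Hfc : forall y, continuous f y) by (intros y; eapply continuous_is_derive, Hf).
  pose (g := fun y => 2 * f y ^ 2 + df y ^ 2).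
  assert (Hg : forall y, continuous g y).
  { intros y. apply (continuous_plus (V := R_NormedModule)).
    - apply (continuous_mult (K := R_AbsRing)); [apply continuous_const | apply continuous_pow2, Hfc].
    - apply continuous_pow2, Hdf. }
  pose (k := fun y => f y ^ 2 + (y - x + 1) * (2 * f y * df y)).
  assert (Hk : forall y, continuous k y).
  { intros y. apply (continuous_plus (V := R_NormedModule)).
    - apply continuous_pow2, Hfc.
    - apply (continuous_mult (K := R_AbsRing)).
      + apply (ex_derive_continuous (V := R_NormedModule)). auto_derive. exact I.
      + apply (continuous_mult (K := R_AbsRing)); [|apply Hdf].
        apply (continuous_mult (K := R_AbsRing)); [apply continuous_const | apply Hfc]. }
  assert (I : is_RInt k (x - 1) x (f x ^ 2)).
  { replace (f x ^ 2) with
      (minus ((x - x + 1) * f x ^ 2) ((x - 1 - x + 1) * f (x - 1) ^ 2))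
      by (unfold minus, plus, opp; simpl; ring).
    apply (is_RInt_derive (fun y => (y - x + 1) * f y ^ 2) k).
    - intros y _. unfold k. auto_derive.
      + exists (df y). apply Hf.
      + replace (Derive (fun z => f z) y) with (df y)
          by (symmetry; apply is_derive_unique, Hf). ring.
    - intros y _. apply Hk. }
  rewrite <- (is_RInt_unique _ _ _ _ I).
  apply Rle_trans with (RInt g (x - 1) x).
  - apply RInt_le; try lra; try (apply ex_RInt_everywhere_continuous; assumption).
    intros y Hy. unfold k, g.
    (* [g - k] is the sum of this term and the next; both are nonnegative for [y] in
       [[x - 1, x]]. *)
    assert (0 <= (y - x + 1) * ((f y - df y) ^ 2)) by (apply Rmult_le_pos; [lra | apply pow2_ge_0]).
    assert (0 <= (x - y) * (f y ^ 2 + df y ^ 2)).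
    { apply Rmult_le_pos; [lra |]. pose proof (pow2_ge_0 (f y)); pose proof (pow2_ge_0 (df y)); lra. }
    nra.
  - apply (RInt_subinterval_le g); auto; try lra.
    intros y. unfold g. pose proof (pow2_ge_0 (f y)); pose proof (pow2_ge_0 (df y)); lra.
Qed.

(** * Continuity on a half-open time strip *)

(* Clamping the time variable makes the one-sided continuity at [ti] two-sided. *)
Definition continuous_on_strip (ti tf : R) (F : R -> R -> R) : Prop :=
  forall t x, ti <= t < tf -> continuity_2d_pt (fun s y => F (Rmax ti s) y) t x.

Lemma continuous_on_strip_plus (ti tf : R) (F G : R -> R -> R) :
  continuous_on_strip ti tf F -> continuous_on_strip ti tf G ->
  continuous_on_strip ti tf (fun t x => F t x + G t x).
Proof. intros HF HG t x Ht. apply continuity_2d_pt_plus; [apply HF | apply HG]; exact Ht. Qed.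

Lemma continuous_on_strip_minus (ti tf : R) (F G : R -> R -> R) :
  continuous_on_strip ti tf F -> continuous_on_strip ti tf G ->
  continuous_on_strip ti tf (fun t x => F t x - G t x).
Proof. intros HF HG t x Ht. apply continuity_2d_pt_minus; [apply HF | apply HG]; exact Ht. Qed.

Lemma continuous_on_strip_mult (ti tf : R) (F G : R -> R -> R) :
  continuous_on_strip ti tf F -> continuous_on_strip ti tf G ->
  continuous_on_strip ti tf (fun t x => F t x * G t x).
Proof. intros HF HG t x Ht. apply continuity_2d_pt_mult; [apply HF | apply HG]; exact Ht. Qed.

Lemma continuous_on_strip_time (ti tf : R) (F : R -> R) :
  (forall t, ti <= t < tf -> continuous F t) -> continuous_on_strip ti tf (fun t _ => F t).
Proof.
  intros HF t x Ht.
  apply (continuity_1d_2d_pt_comp F (fun s _ => Rmax ti s)).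
  - rewrite Rmax_right by lra. apply continuity_pt_filterlim, HF, Ht.
  - intros eps. exists eps. intros u v Hu _.
    revert Hu. unfold Rmax. destruct (Rle_dec ti u), (Rle_dec ti t);
      unfold Rabs; repeat destruct Rcase_abs; destruct eps; simpl; lra.
Qed.

Lemma continuous_on_strip_interior (ti tf : R) (F : R -> R -> R) (t x : R) :
  continuous_on_strip ti tf F -> ti < t < tf -> continuity_2d_pt F t x.
Proof.
  intros HF Ht.
  apply (continuity_2d_pt_ext_loc (fun s y => F (Rmax ti s) y)).
  - assert (H : 0 < t - ti) by lra. exists (mkposreal _ H). simpl. intros u v Hu _.
    rewrite Rmax_right; auto. revert Hu. unfold Rabs; destruct Rcase_abs; lra.
  - apply HF. lra.
Qed.

Lemma continuous_on_strip_slice (ti tf : R) (F : R -> R -> R) (t x : R) :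
  continuous_on_strip ti tf F -> ti <= t < tf -> continuous (F t) x.
Proof.
  intros HF Ht. apply continuity_pt_filterlim. intros eps Heps.
  destruct (HF t x Ht (mkposreal eps Heps)) as [d Hd].
  exists d. split; [apply cond_pos|]. intros y [_ Hy].
  specialize (Hd t y). simpl in Hd. rewrite (Rmax_right ti t) in Hd by lra.
  apply Hd; [rewrite Rminus_diag, Rabs_R0; apply cond_pos | exact Hy].
Qed.

(** * Energy estimate on truncated backward cones *)

(** On the compact interval [[a, b]], continuity at time [ti] is uniform in [x]. This carries
    estimates proved for times after [ti] down to [ti] itself. *)
Lemma RInt_time_right_continuous (ti tf a b eps : R) (F : R -> R -> R) :
  ti < tf -> a <= b -> 0 < eps -> continuous_on_strip ti tf F ->
  exists d, 0 < d /\ forall t, ti <= t < tf -> t <= ti + d ->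
    RInt (F t) a b <= RInt (F ti) a b + eps.
Proof.
  intros Htf Hab Heps HF.
  assert (Hb : 0 < b - a + 1) by lra.
  (* The added 1 keeps the denominator positive when [a = b]. *)
  assert (He : 0 < eps / (b - a + 1)) by (apply Rdiv_lt_0_compat; lra).
  destruct (uniform_continuity_2d_1d' (fun s y => F (Rmax ti s) y) a b ti) with (eps := mkposreal _ He)
    as [d Hd].
  { intros x _. apply HF. lra. }
  exists d. split; [apply cond_pos|]. intros t Ht Htd.
  assert (E : forall s, ti <= s < tf -> ex_RInt (F s) a b).
  { intros s Hs. apply ex_RInt_everywhere_continuous. intros x.
    apply continuous_on_strip_slice with ti tf; auto. }
  assert (Eti : ex_RInt (F ti) a b) by (apply E; lra).
  assert (H : Rabs (RInt (fun x => F t x - F ti x) a b) <= (b - a) * (eps / (b - a + 1))).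
  { apply abs_RInt_le_const; auto.
    - apply (ex_RInt_minus (V := R_NormedModule)); auto.
    - intros x Hx. left.
      pose proof (cond_pos d) as Hdp.
      specialize (Hd x ti x t). simpl in Hd.
      rewrite !Rmax_right in Hd by lra. apply Hd; try lra.
      rewrite Rminus_diag, Rabs_R0. exact Hdp. }
  assert (X : RInt (fun x => F t x - F ti x) a b = RInt (F t) a b - RInt (F ti) a b)
    by (apply (RInt_minus (V := R_CompleteNormedModule)); auto).
  rewrite X in H.
  assert ((b - a) * (eps / (b - a + 1)) <= eps).
  { apply Rmult_le_reg_r with (b - a + 1); [lra|]. field_simplify; [nra|lra]. }
  pose proof (Rle_abs (RInt (F t) a b - RInt (F ti) a b)). lra.
Qed.

(** Integrate [et + flx] over the cone whose section at time [t] is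
    [Rabs (x - x0) <= 1 + L * (T - t)]. Its sides close in at speed [L], and [Rabs fl <= L * e]
    makes their contribution nonpositive, so the energy of a section grows at rate at most [H]. *)
Lemma local_energy_estimate (ti tf T x0 L H : R) (e et fl flx : R -> R -> R) :
  ti <= T < tf -> 0 <= L -> 0 <= H ->
  continuous_on_strip ti tf e -> continuous_on_strip ti tf et ->
  (forall t x, ti < t < tf -> is_derive (fun s => e s x) t (et t x)) ->
  (forall t x, ti <= t < tf -> is_derive (fl t) x (flx t x)) ->
  (forall t x, ti <= t < tf -> continuous (flx t) x) ->
  (forall t x, ti <= t < tf -> 0 <= e t x) ->
  (forall t x, ti <= t <= T -> Rabs (fl t x) <= L * e t x) ->
  (forall t, ti <= t <= T ->
     RInt (fun x => et t x + flx t x) (x0 - 1 - L * (T - t)) (x0 + 1 + L * (T - t)) <= H) ->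
  RInt (e T) (x0 - 1) (x0 + 1)
    <= RInt (e ti) (x0 - 1 - L * (T - ti)) (x0 + 1 + L * (T - ti)) + H * (T - ti).
Proof.
  intros HT HL HH Hec Hetc Het Hfl Hflxc Hep Hcone HI.
  assert (Hslice : forall t x, ti <= t < tf -> continuous (e t) x)
    by (intros; apply continuous_on_strip_slice with ti tf; auto).
  assert (Hex : forall t a b, ti <= t < tf -> ex_RInt (e t) a b)
    by (intros; apply ex_RInt_everywhere_continuous; auto).
  destruct (Req_dec T ti) as [->|HTne].
  { rewrite !Rminus_diag, !Rmult_0_r, Rminus_0_r, !Rplus_0_r. apply Rle_refl. }
  set (a := fun t => x0 - 1 - L * (T - t)).
  set (b := fun t => x0 + 1 + L * (T - t)).
  set (F := fun t => RInt (fun x => e t x) (a t) (b t)).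
  set (dF := fun t => RInt (fun x => et t x) (a t) (b t) + - e t (a t) * L + e t (b t) * - L).
  assert (Hloc : forall t, ti < t < tf -> locally t (fun s => ti < s < tf)).
  { intros t Ht. apply (open_and _ _ (open_gt ti) (open_lt tf)). exact Ht. }
  assert (HdF : forall t, ti < t < tf -> is_derive F t (dF t)).
  { intros t Ht.
    (* Differentiating the integral with moving endpoints requires joint continuity of the time
       derivative near [(t, y)]. It is inherited from [et], with which [Derive] agrees at interior
       times. *)
    assert (Hder : forall u v, ti < u < tf -> Derive (fun z => e z v) u = et u v)
      by (intros; apply is_derive_unique, Het; auto).
    assert (Hdc : forall u v, ti < u < tf ->
      continuity_2d_pt (fun u v => Derive (fun z => e z v) u) u v).
    { intros u v Hu. apply (continuity_2d_pt_ext_loc et).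
      - destruct (Hloc u Hu) as [d Hd]. exists d. intros u' v' Hu' _.
        symmetry. apply Hder, Hd, Hu'.
      - apply continuous_on_strip_interior with ti tf; auto. }
    assert (Hdl : forall y, locally_2d (fun u v =>
      continuity_2d_pt (fun u v => Derive (fun z => e z v) u) u v) t y).
    { intros y. destruct (Hloc t Ht) as [d Hd]. exists d. intros u' v' Hu' _.
      apply Hdc, Hd, Hu'. }
    assert (HlocR : forall c d, locally t (fun s => ex_RInt (fun x => e s x) c d)).
    { intros c d. apply filter_imp with (2 := Hloc t Ht). intros s Hs. apply Hex. lra. }
    replace (dF t) with (RInt (fun x => Derive (fun u => e u x) t) (a t) (b t)
       + - e t (a t) * L + e t (b t) * - L).
    2: { unfold dF. do 2 f_equal. apply RInt_ext. intros x _. apply Hder, Ht. }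
    apply is_derive_RInt_param_bound_comp; auto.
    - exists (mkposreal 1 Rlt_0_1). auto.
    - exists (mkposreal 1 Rlt_0_1). auto.
    - unfold a. auto_derive; auto. simpl. lra.
    - unfold b. auto_derive; auto. simpl. lra.
    - exists (mkposreal 1 Rlt_0_1). apply filter_imp with (2 := Hloc t Ht).
      intros s Hs x _. exists (et s x). apply Het, Hs.
    - apply continuity_pt_filterlim, Hslice. lra.
    - apply continuity_pt_filterlim, Hslice. lra. }
  assert (HdFle : forall t, ti < t <= T -> dF t <= H).
  { intros t Ht.
    assert (Htf : ti <= t < tf) by lra.
    assert (Hab : a t <= b t) by (unfold a, b; assert (0 <= L * (T - t)) by (apply Rmult_le_pos; lra); lra).
    assert (Eet : ex_RInt (et t) (a t) (b t)).
    { apply ex_RInt_everywhere_continuous. intros x. apply continuous_on_strip_slice with ti tf; auto. }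
    assert (Ifl : is_RInt (flx t) (a t) (b t) (fl t (b t) - fl t (a t))).
    { apply (is_RInt_derive (V := R_CompleteNormedModule) (fl t) (flx t)); intros; [apply Hfl | apply Hflxc]; auto. }
    assert (X : RInt (fun x => et t x + flx t x) (a t) (b t)
             = RInt (et t) (a t) (b t) + (fl t (b t) - fl t (a t))).
    { rewrite <- (is_RInt_unique _ _ _ _ Ifl).
      apply (RInt_plus (V := R_CompleteNormedModule)); auto. eexists; apply Ifl. }
    assert (Y : RInt (fun x => et t x + flx t x) (a t) (b t) <= H) by (apply HI; lra).
    unfold dF.
    change (RInt (fun x => et t x) (a t) (b t)) with (RInt (et t) (a t) (b t)).
    (* Each end of the shrinking section loses [L * e], which is at least the flux through it. *)
    assert (Ha : Rabs (fl t (a t)) <= L * e t (a t)) by (apply Hcone; lra).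
    assert (Hb : Rabs (fl t (b t)) <= L * e t (b t)) by (apply Hcone; lra).
    apply Rabs_le_between in Ha. apply Rabs_le_between in Hb. lra. }
  assert (Hmono : forall t, ti < t <= T -> F T <= F t + H * (T - t)).
  { intros t Ht.
    destruct (MVT_gen F t T dF) as [c [Hc Hc']];
      rewrite ?Rmin_left, ?Rmax_right in * by lra.
    - intros s Hs. apply HdF. lra.
    - intros s Hs. apply continuity_pt_filterlim, (continuous_is_derive _ _ (dF s)), HdF. lra.
    - assert (dF c <= H) by (apply HdFle; lra).
      assert (dF c * (T - t) <= H * (T - t)) by (apply Rmult_le_compat_r; lra). lra. }
  assert (HFT : F T = RInt (e T) (x0 - 1) (x0 + 1)).
  { unfold F, a, b. rewrite Rminus_diag, Rmult_0_r, Rminus_0_r, Rplus_0_r. reflexivity. }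
  rewrite <- HFT.
  (* The derivative of [F] is known only after [ti]. Take [s] slightly later, enlarge the section at
     [s] to the fixed interval [[a ti, b ti]], and pass from [s] to [ti] at the cost of [eps]. *)
  apply le_epsilon. intros eps Heps.
  assert (HLT : 0 <= L * (T - ti)) by (apply Rmult_le_pos; lra).
  destruct (RInt_time_right_continuous ti tf (a ti) (b ti) eps e) as [d [Hd Hd']]; auto; try lra.
  { unfold a, b. lra. }
  set (s := Rmin T (ti + d)).
  assert (Hs : ti < s <= T /\ s <= ti + d).
  { unfold s. repeat split; [apply Rmin_glb_lt; lra | apply Rmin_l | apply Rmin_r]. }
  assert (Hm := Hmono s (proj1 Hs)).
  assert (Hn : F s <= RInt (e s) (a ti) (b ti)).
  { apply (RInt_subinterval_le (e s)).
    - intros x. apply Hslice. lra.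
    - intros x. apply Hep. lra.
    - unfold a. assert (L * (T - s) <= L * (T - ti)) by (apply Rmult_le_compat_l; lra). lra.
    - unfold a, b. assert (0 <= L * (T - s)) by (apply Rmult_le_pos; lra). lra.
    - unfold b. assert (L * (T - s) <= L * (T - ti)) by (apply Rmult_le_compat_l; lra). lra. }
  assert (Hk : RInt (e s) (a ti) (b ti) <= RInt (e ti) (a ti) (b ti) + eps) by (apply Hd'; lra).
  assert (H * (T - s) <= H * (T - ti)) by (apply Rmult_le_compat_l; lra).
  unfold a, b in *. lra.
Qed.

(** * Continuity and time derivatives of a function smooth on the strip *)

(** Clamping at [ti] does not increase the distance to [t], and a radius of at most [tf - t] keeps
    the clamped time below [tf], hence inside the strip where the limit is taken. *)
Lemma continuous_on_strip_of_smooth (ti tf : R) (phi : R -> R -> R)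
    (D : nat -> nat -> R -> R -> R) (n m : nat) :
  smooth_strip ti tf phi D -> continuous_on_strip ti tf (D n m).
Proof.
  intros HD t x Ht eps.
  destruct (HD n m t x Ht) as [_ [_ [_ Hc]]].
  destruct (proj1 (filterlim_locally (U := R_UniformSpace) _ _) Hc eps) as [d Hd].
  assert (Hp : 0 < Rmin d (tf - t)) by (apply Rmin_glb_lt; [apply cond_pos | lra]).
  exists (mkposreal _ Hp). simpl. intros u v Hu Hv.
  rewrite (Rmax_right ti t) by lra.
  pose proof (Rmin_l d (tf - t)). pose proof (Rmin_r d (tf - t)).
  assert (Hu' : Rabs (Rmax ti u - t) <= Rabs (u - t)).
  { unfold Rmax; destruct (Rle_dec ti u); [lra|].
    unfold Rabs; repeat destruct Rcase_abs; lra. }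
  assert (Hu2 : Rmax ti u < tf).
  { revert Hu'. unfold Rabs at 1. destruct Rcase_abs; lra. }
  apply (Hd (Rmax ti u, v)).
  - split; simpl.
    + change (Rabs (Rmax ti u - t) < d). lra.
    + change (Rabs (v - x) < d). lra.
  - simpl. split; [apply Rmax_l | exact Hu2].
Qed.

(** A small neighbourhood of an interior time lies in the strip, so the derivative within the strip
    is an ordinary one there. *)
Lemma is_derive_time_of_smooth (ti tf : R) (phi : R -> R -> R)
    (D : nat -> nat -> R -> R -> R) (n m : nat) (t x : R) :
  smooth_strip ti tf phi D -> ti < t < tf ->
  is_derive (fun s => D n m s x) t (D (S n) m t x).
Proof.
  intros HD Ht.
  assert (Ht' : ti <= t < tf) by lra.
  destruct (HD n m t x Ht') as [_ [Hd _]].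
  apply is_derive_Reals. intros eps Heps.
  destruct (proj1 (filterlim_locally (U := R_UniformSpace) _ _) Hd (mkposreal eps Heps)) as [d Hd'].
  assert (Hp : 0 < Rmin d (Rmin (t - ti) (tf - t)))
    by (apply Rmin_glb_lt; [apply cond_pos | apply Rmin_glb_lt; lra]).
  exists (mkposreal _ Hp). simpl. intros h Hh Hh'.
  pose proof (Rmin_l d (Rmin (t - ti) (tf - t))).
  pose proof (Rmin_r d (Rmin (t - ti) (tf - t))).
  pose proof (Rmin_l (t - ti) (tf - t)). pose proof (Rmin_r (t - ti) (tf - t)).
  assert (Hb : - Rmin (t - ti) (tf - t) < h < Rmin (t - ti) (tf - t))
    by (apply Rabs_lt_between; lra).
  specialize (Hd' (t + h)). simpl in Hd'.
  replace (t + h - t) with h in Hd' by ring.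
  apply Hd'.
  - change (Rabs (t + h - t) < d). replace (t + h - t) with h by ring. lra.
  - split; lra.
Qed.

(** * Horizons, the range of [kappa] and the characteristic speeds *)

Lemma nu_bounds (lam : R) : 0 < lam < 1/16 ->
  0 < nu lam < 1 /\ nu lam * nu lam = 1 - 16 * lam.
Proof.
  intros Hl. unfold nu.
  assert (E : sqrt (1 - 16 * lam) * sqrt (1 - 16 * lam) = 1 - 16 * lam)
    by (apply sqrt_sqrt; lra).
  assert (0 < sqrt (1 - 16 * lam)) by (apply sqrt_lt_R0; lra).
  repeat split; auto. nra.
Qed.

(** After multiplication by [16 * lam], and with [1 - 16 * lam = nu^2], the claim reads
    [nu^2 - nu < 32 * lam^2], true because [0 < nu < 1]. It makes the damping coefficient
    [6 - 2 * kappa] positive. *)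
Lemma kappa1_lt_3 (lam : R) : 0 < lam < 1/16 -> kappa1 lam < 3.
Proof.
  intros Hl. destruct (nu_bounds lam Hl) as [Hn Hn2]. unfold kappa1.
  apply Rmult_lt_reg_r with (16 * lam); [lra|].
  unfold Rdiv. rewrite Rmult_assoc, Rinv_l by lra.
  assert (nu lam * nu lam < nu lam) by nra. nra.
Qed.

(** Vieta's relations for the roots of [lam * t^2 - t / 2 + 1], which is [1 - t * Gf lam t]. *)
Lemma t1_t2_spec (lam : R) : 0 < lam < 1/16 ->
  0 < t1 lam < t2 lam /\ 2 * lam * (t1 lam + t2 lam) = 1 /\ lam * t1 lam * t2 lam = 1.
Proof.
  intros Hl. destruct (nu_bounds lam Hl) as [Hn Hn2]. unfold t1, t2.
  repeat split.
  - apply Rdiv_lt_0_compat; lra.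
  - apply Rmult_lt_compat_r; [apply Rinv_0_lt_compat|]; lra.
  - field. lra.
  - replace (lam * ((1 - nu lam) / (4 * lam)) * ((1 + nu lam) / (4 * lam)))
      with ((1 - nu lam * nu lam) / (16 * lam)) by (field; lra).
    rewrite Hn2. field. lra.
Qed.

(* The slopes of the two families of characteristics are [outspeed] and [- 1 / t]:
   since [beta^2 - alpha * gamma = 1], they are [(beta - 1) / alpha] and [(beta + 1) / alpha]. *)
Definition outspeed (lam t : R) : R := Gf lam t / (1 - t * Gf lam t).

Lemma horizon_factor (lam t : R) : 0 < lam < 1/16 ->
  1 - t * Gf lam t = lam * (t1 lam - t) * (t2 lam - t).
Proof.
  intros Hl. destruct (t1_t2_spec lam Hl) as [_ [Hs Hp]]. unfold Gf.
  replace (lam * (t1 lam - t) * (t2 lam - t)) with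
    (lam * t1 lam * t2 lam - t * (2 * lam * (t1 lam + t2 lam)) / 2 + lam * t * t) by field.
  rewrite Hs, Hp. field.
Qed.

Lemma horizon_factor_pos (lam t : R) : 0 < lam < 1/16 -> t < t1 lam ->
  0 < 1 - t * Gf lam t.
Proof.
  intros Hl Ht. destruct (t1_t2_spec lam Hl) as [H12 _].
  rewrite horizon_factor by auto.
  repeat apply Rmult_lt_0_compat; lra.
Qed.

(** Since [Gf lam t = lam * (t1 + t2 - t)], the product equals [(t1 + t2 - t) / (t2 - t)]. The lower
    bound measures the strength of the damping, the upper one the size of the singular cross
    term. *)
Lemma outspeed_bounds (lam t : R) : 0 < lam < 1/16 -> 0 < t < t1 lam ->
  1 <= (t1 lam - t) * outspeed lam t <= (t1 lam + t2 lam) / (t2 lam - t1 lam).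
Proof.
  intros Hl Ht. destruct (t1_t2_spec lam Hl) as [H12 [Hs Hp]].
  assert (E : (t1 lam - t) * outspeed lam t = (t1 lam + t2 lam - t) / (t2 lam - t)).
  { unfold outspeed. rewrite horizon_factor by auto.
    replace (Gf lam t) with (lam * (t1 lam + t2 lam - t)).
    - field. repeat split; lra.
    - unfold Gf. nra. }
  rewrite E. split.
  - apply Rmult_le_reg_r with (t2 lam - t); [lra|].
    unfold Rdiv. rewrite Rmult_assoc, Rinv_l by lra. lra.
  - apply Rmult_le_compat; try lra.
    + left. apply Rinv_0_lt_compat. lra.
    + apply Rinv_le_contravar; lra.
Qed.

(** * The quadratic form of the energy production *)

(** Here [w] stands for [t1 - t], [h] for the weight [w^dl], [b1] for [outspeed], [b2] for [/ t],
    [V] for the potential, [p] and [r] for the Riemann invariants, [y] for [phi] and [S] for the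
    source. Bounded coefficients are absorbed by [K]. The cross term [(b1 + b2) * p * y] costs a
    multiple of [h / w * y^2], which is integrable in time and is paid by the part [B^2 / c * h / w]
    of the rate. *)
Lemma energy_production_algebra
    (c dl K B W Hm M w h b1 b2 V p r y S : R) :
  0 < c -> 0 < w -> 0 < h <= Hm -> w <= W * h -> dl <= c / 2 ->
  1 <= w * b1 -> 0 <= b2 -> w * (b1 + b2) <= B ->
  0 <= M -> Rabs (c * b2) <= M -> Rabs (c ^ 2 * b2 - 2 * V) <= M ->
  M * Hm <= K -> 3 * W * M ^ 2 / c + 2 * M + 1 <= K ->
  (- K - B ^ 2 / c * h / w + dl / w - c * b1) * (p ^ 2 / h)
  + p / h * (c * b2 * (r + c * y) - 2 * V * y + 2 * S)
  + (- K - B ^ 2 / c * h / w) * (r ^ 2 + y ^ 2)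
  + r * (c * b2 * (p + r + c * y) - 2 * V * y + 2 * S)
  - (b1 + b2) * p * y
  <= (12 * W / c + 1) * S ^ 2.
Proof.
  intros Hc Hw Hh HW Hdl Hb1 Hb2 HB HM HM1 HM2 HK1 HK2.
  set (u := c * b2) in *.
  set (v := c ^ 2 * b2 - 2 * V) in *.
  replace (u * (p + r + c * y) - 2 * V * y + 2 * S) with (u * (p + r) + v * y + 2 * S)
    by (unfold u, v; ring).
  replace (u * (r + c * y) - 2 * V * y + 2 * S) with (u * r + v * y + 2 * S)
    by (unfold u, v; ring).
  clearbody u v.
  assert (Hh0 : 0 < / h) by (apply Rinv_0_lt_compat; lra).
  assert (Hw0 : 0 < / w) by (apply Rinv_0_lt_compat; lra).
  assert (Hc0 : 0 < / c) by (apply Rinv_0_lt_compat; lra).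
  assert (HW0 : 0 < W) by nra.
  assert (Hwh : w / h <= W).
  { apply Rmult_le_reg_r with h; [lra|]. unfold Rdiv. rewrite Rmult_assoc, Rinv_l; lra. }
  assert (Hu2 : u ^ 2 <= M ^ 2) by (rewrite <- (pow2_abs u); apply pow_incr; split; [apply Rabs_pos | auto]).
  assert (Hv2 : v ^ 2 <= M ^ 2) by (rewrite <- (pow2_abs v); apply pow_incr; split; [apply Rabs_pos | auto]).
  set (X := u * r + v * y + 2 * S).
  (* [X] collects all that drives [p] apart from the damping; its coefficients stay bounded up to
     [t1]. *)
  assert (HX : X ^ 2 <= 3 * M ^ 2 * (r ^ 2 + y ^ 2) + 12 * S ^ 2).
  { assert (X ^ 2 <= 3 * ((u * r) ^ 2 + (v * y) ^ 2 + (2 * S) ^ 2)).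
    { unfold X. pose proof (pow2_ge_0 (u * r - v * y)). pose proof (pow2_ge_0 (u * r - 2 * S)).
      pose proof (pow2_ge_0 (v * y - 2 * S)). nra. }
    assert ((u * r) ^ 2 <= M ^ 2 * r ^ 2)
      by (rewrite Rpow_mult_distr; apply Rmult_le_compat_r; [apply pow2_ge_0 | auto]).
    assert ((v * y) ^ 2 <= M ^ 2 * y ^ 2)
      by (rewrite Rpow_mult_distr; apply Rmult_le_compat_r; [apply pow2_ge_0 | auto]).
    nra. }
  assert (Hcwh : 0 <= c / (4 * w) * / h).
  { apply Rmult_le_pos; [left; apply Rdiv_lt_0_compat |]; lra. }
  (* Young: the singular damping [- c b1 p^2 / h] pays for both singular cross terms. *)
  assert (Y1 : p / h * X <= c / (4 * w) * (p ^ 2 / h) + W / c * X ^ 2).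
  { assert (E : c / (4 * w) * (p ^ 2 / h) + w / h / c * X ^ 2 - p / h * X
      = c / (4 * w) * / h * (p - 2 * w / c * X) ^ 2) by (field; lra).
    assert (0 <= c / (4 * w) * / h * (p - 2 * w / c * X) ^ 2).
    { apply Rmult_le_pos; [exact Hcwh | apply pow2_ge_0]. }
    assert (w / h / c * X ^ 2 <= W / c * X ^ 2).
    { apply Rmult_le_compat_r; [apply pow2_ge_0|]. apply Rmult_le_compat_r; lra. }
    lra. }
  assert (Y2 : - (b1 + b2) * p * y <= c / (4 * w) * (p ^ 2 / h) + B ^ 2 / c * h / w * y ^ 2).
  { assert (E : c / (4 * w) * (p ^ 2 / h) + (w * (b1 + b2)) ^ 2 / c * h / w * y ^ 2
       + (b1 + b2) * p * y
      = c / (4 * w) * / h * (p + 2 * w * h / c * (b1 + b2) * y) ^ 2) by (field; lra).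
    assert (0 <= c / (4 * w) * / h * (p + 2 * w * h / c * (b1 + b2) * y) ^ 2).
    { apply Rmult_le_pos; [exact Hcwh | apply pow2_ge_0]. }
    assert ((w * (b1 + b2)) ^ 2 <= B ^ 2).
    { apply pow_incr. split; [|lra]. nra. }
    assert ((w * (b1 + b2)) ^ 2 / c * h / w * y ^ 2 <= B ^ 2 / c * h / w * y ^ 2).
    { unfold Rdiv. repeat apply Rmult_le_compat_r; try lra. apply pow2_ge_0. }
    lra. }
  (* The equation of [r] has no singular coefficient, so Young's inequality with constant weights
     suffices. *)
  assert (Hr : r * (u * (p + r) + v * y + 2 * S)
     <= M * p ^ 2 + (2 * M + 1) * r ^ 2 + M * y ^ 2 + S ^ 2).
  { apply Rabs_le_between in HM1. apply Rabs_le_between in HM2.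
    assert (u * (r * p) <= M * ((r ^ 2 + p ^ 2) / 2)).
    { pose proof (pow2_ge_0 (r - p)). pose proof (pow2_ge_0 (r + p)).
      destruct (Rle_dec 0 (r * p)); nra. }
    assert (v * (r * y) <= M * ((r ^ 2 + y ^ 2) / 2)).
    { pose proof (pow2_ge_0 (r - y)). pose proof (pow2_ge_0 (r + y)).
      destruct (Rle_dec 0 (r * y)); nra. }
    assert (u * r ^ 2 <= M * r ^ 2) by (apply Rmult_le_compat_r; [apply pow2_ge_0 | lra]).
    pose proof (pow2_ge_0 (r - S)).
    assert (0 <= M * p ^ 2) by (apply Rmult_le_pos; [lra | apply pow2_ge_0]).
    assert (0 <= M * y ^ 2) by (apply Rmult_le_pos; [lra | apply pow2_ge_0]).
    nra. }
  assert (HK2' : 0 <= B ^ 2 / c * h / w).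
  { unfold Rdiv. repeat (apply Rmult_le_pos; [|lra]). apply pow2_ge_0. }
  assert (Hph : 0 <= p ^ 2 / h) by (apply Rmult_le_pos; [apply pow2_ge_0 | lra]).
  (* Budget of the damping [c * b1 >= c / w]: at most [c / (2 * w)] pays for the derivative of the
     weight, and [c / (4 * w)] for each of [Y1] and [Y2]. *)
  assert (Hdamp : dl / w - c * b1 + c / (4 * w) + c / (4 * w) <= 0).
  { assert (Hb1' : / w <= b1).
    { apply Rmult_le_reg_l with w; [lra|]. rewrite Rinv_r; lra. }
    assert (c * / w <= c * b1) by (apply Rmult_le_compat_l; lra).
    assert (dl * / w <= c / 2 * / w) by (apply Rmult_le_compat_r; lra).
    replace (c / (4 * w)) with (c / 4 * / w) by (field; lra).
    unfold Rdiv in *. lra. }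
  assert (HpK : M * p ^ 2 <= K * (p ^ 2 / h)).
  { assert (M * h <= K) by nra.
    replace (M * p ^ 2) with (M * h * (p ^ 2 / h)) by (field; lra).
    apply Rmult_le_compat_r; auto. }
  assert (HWX : W / c * X ^ 2 <= 3 * W * M ^ 2 / c * (r ^ 2 + y ^ 2) + 12 * W / c * S ^ 2).
  { replace (3 * W * M ^ 2 / c * (r ^ 2 + y ^ 2) + 12 * W / c * S ^ 2)
      with (W / c * (3 * M ^ 2 * (r ^ 2 + y ^ 2) + 12 * S ^ 2)) by (field; lra).
    apply Rmult_le_compat_l; auto. apply Rmult_le_pos; lra. }
  pose proof (pow2_ge_0 r). pose proof (pow2_ge_0 y).
  set (k3 := 3 * W * M ^ 2 / c) in *.
  set (k2 := B ^ 2 / c * h / w) in *.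
  set (P := p ^ 2 / h) in *.
  assert (0 <= k2 * P) by (apply Rmult_le_pos; auto).
  assert (0 <= k2 * r ^ 2) by (apply Rmult_le_pos; auto).
  assert ((dl / w - c * b1 + c / (4 * w) + c / (4 * w)) * P <= 0) by nra.
  assert ((k3 + 2 * M + 1) * (r ^ 2 + y ^ 2) <= K * (r ^ 2 + y ^ 2))
    by (apply Rmult_le_compat_r; lra).
  assert (0 <= M * y ^ 2) by (apply Rmult_le_pos; auto).
  nra.
Qed.

(** * Derivatives of the coefficients and the potential *)

Lemma is_derive_alphaf (lam t : R) : is_derive (alphaf lam) t (Derive (alphaf lam) t).
Proof. apply Derive_correct. unfold alphaf, Gf. auto_derive. exact I. Qed.

Lemma is_derive_betaf (lam t : R) : is_derive (betaf lam) t (4 * lam * t - 1).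
Proof. unfold betaf, Gf. auto_derive; [exact I | field]. Qed.

Lemma Derive_betaf (lam t : R) : Derive (betaf lam) t = 4 * lam * t - 1.
Proof. apply is_derive_unique, is_derive_betaf. Qed.

Definition potential (lam : R) (l : nat) (kappa t : R) : R :=
  (4 - kappa) * Derive (betaf lam) t + (8 - 6 * kappa + kappa ^ 2) * gammaf lam t - ellf l.

(** From [4 * lam * t < 2 * lam * (t1 + t2) = 1], the derivative of [betaf] lies in [(-1, 0)];
    [gammaf] lies in [(0, 1)]. *)
Lemma potential_bounded (lam : R) (l : nat) (kappa t : R) :
  0 < lam < 1/16 -> 0 < t < t1 lam ->
  Rabs (potential lam l kappa t)
    <= Rabs (4 - kappa) + Rabs (8 - 6 * kappa + kappa ^ 2) + Rabs (ellf l).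
Proof.
  intros Hl Ht. unfold potential. rewrite Derive_betaf.
  assert (Hlt : 0 < 4 * lam * t < 1).
  { destruct (t1_t2_spec lam Hl) as [H12 [Hs _]]. nra. }
  assert (E1 : Rabs (4 * lam * t - 1) <= 1) by (apply Rabs_le; lra).
  assert (E2 : Rabs (gammaf lam t) <= 1) by (apply Rabs_le; unfold gammaf, Gf; lra).
  unfold Rminus at 1. eapply Rle_trans; [apply Rabs_triang|].
  rewrite Rabs_Ropp. apply Rplus_le_compat_r.
  eapply Rle_trans; [apply Rabs_triang|]. rewrite !Rabs_mult.
  pose proof (Rabs_pos (4 - kappa)). pose proof (Rabs_pos (8 - 6 * kappa + kappa ^ 2)).
  apply Rplus_le_compat; rewrite <- (Rmult_1_r (Rabs _)) at 2; apply Rmult_le_compat_l; auto.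
Qed.

(** * Riemann invariants and their transport equations *)

(* Riemann invariants: with [psi = alpha * phi_t + beta * phi_x], these are [psi + phi_x] and
   [psi - phi_x - (6 - 2 kappa) phi]. Subtracting the multiple of [phi] removes from the second
   transport equation the coefficient that blows up at [t1]. *)
Definition pinv (lam : R) (D : nat -> nat -> R -> R -> R) (t x : R) : R :=
  alphaf lam t * D 1%nat 0%nat t x + (betaf lam t + 1) * D 0%nat 1%nat t x.
Definition pinv_t (lam : R) (D : nat -> nat -> R -> R -> R) (t x : R) : R :=
  Derive (alphaf lam) t * D 1%nat 0%nat t x + alphaf lam t * D 2%nat 0%nat t x
  + (Derive (betaf lam) t * D 0%nat 1%nat t x + (betaf lam t + 1) * D 1%nat 1%nat t x).
Definition pinv_x (lam : R) (D : nat -> nat -> R -> R -> R) (t x : R) : R :=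
  alphaf lam t * D 1%nat 1%nat t x + (betaf lam t + 1) * D 0%nat 2%nat t x.

Definition rinv (lam kappa : R) (D : nat -> nat -> R -> R -> R) (t x : R) : R :=
  alphaf lam t * D 1%nat 0%nat t x + (betaf lam t - 1) * D 0%nat 1%nat t x
  - (6 - 2 * kappa) * D 0%nat 0%nat t x.
Definition rinv_t (lam kappa : R) (D : nat -> nat -> R -> R -> R) (t x : R) : R :=
  Derive (alphaf lam) t * D 1%nat 0%nat t x + alphaf lam t * D 2%nat 0%nat t x
  + (Derive (betaf lam) t * D 0%nat 1%nat t x + (betaf lam t - 1) * D 1%nat 1%nat t x)
  - (6 - 2 * kappa) * D 1%nat 0%nat t x.
Definition rinv_x (lam kappa : R) (D : nat -> nat -> R -> R -> R) (t x : R) : R :=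
  alphaf lam t * D 1%nat 1%nat t x + (betaf lam t - 1) * D 0%nat 2%nat t x
  - (6 - 2 * kappa) * D 0%nat 1%nat t x.

(** The source is a plain number [S], so that the transport equations become algebraic identities
    between the values of [D] at one point. *)
Definition solves_at (lam : R) (l : nat) (kappa S : R)
    (D : nat -> nat -> R -> R -> R) (t x : R) : Prop :=
  alphaf lam t * D 2%nat 0%nat t x + 2 * betaf lam t * D 1%nat 1%nat t x
  + gammaf lam t * D 0%nat 2%nat t x
  + (Derive (alphaf lam) t + (6 - 2 * kappa) * betaf lam t) * D 1%nat 0%nat t x
  + (Derive (betaf lam) t + (6 - 2 * kappa) * gammaf lam t) * D 0%nat 1%nat t x
  + potential lam l kappa t * D 0%nat 0%nat t x = S.

(** With [b = outspeed], [b * alpha = beta - 1] and [b * (beta + 1) = gamma], so the left side has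
    the principal part of the equation. The first-order terms follow from [2 * (beta * phi_t + gamma
    * phi_x) = b * p - q / t], where [q = r + (6 - 2 * kappa) * phi]. *)
Lemma pinv_transport (lam : R) (l : nat) (kappa S : R)
    (D : nat -> nat -> R -> R -> R) (t x : R) :
  0 < lam < 1/16 -> 0 < t < t1 lam -> solves_at lam l kappa S D t x ->
  2 * (pinv_t lam D t x + outspeed lam t * pinv_x lam D t x)
  = - (6 - 2 * kappa) * outspeed lam t * pinv lam D t x
    + (6 - 2 * kappa) * / t * (rinv lam kappa D t x + (6 - 2 * kappa) * D 0%nat 0%nat t x)
    - 2 * potential lam l kappa t * D 0%nat 0%nat t x + 2 * S.
Proof.
  intros Hl Ht HS. pose proof (horizon_factor_pos lam t Hl (proj2 Ht)) as Hg.
  unfold solves_at in HS. rewrite <- HS.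
  unfold pinv_t, pinv_x, pinv, rinv, outspeed.
  generalize (Derive (alphaf lam) t) (Derive (betaf lam) t) (potential lam l kappa t).
  intros a' b' V. unfold alphaf, betaf, gammaf.
  field. lra.
Qed.

(** Along its own characteristics [q] has the same right side as [p]. Subtracting [c * phi], with
    [c = 6 - 2 * kappa], adds [c * (b + / t) * p / 2], which cancels the singular
    [- c * b * p / 2]. *)
Lemma rinv_transport (lam : R) (l : nat) (kappa S : R)
    (D : nat -> nat -> R -> R -> R) (t x : R) :
  0 < t -> solves_at lam l kappa S D t x ->
  2 * (rinv_t lam kappa D t x - / t * rinv_x lam kappa D t x)
  = (6 - 2 * kappa) * / t * (pinv lam D t x + rinv lam kappa D t x
                             + (6 - 2 * kappa) * D 0%nat 0%nat t x)
    - 2 * potential lam l kappa t * D 0%nat 0%nat t x + 2 * S.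
Proof.
  intros Ht HS. unfold solves_at in HS. rewrite <- HS.
  unfold rinv_t, rinv_x, pinv, rinv.
  generalize (Derive (alphaf lam) t) (Derive (betaf lam) t) (potential lam l kappa t).
  intros a' b' V. unfold alphaf, betaf, gammaf.
  field. lra.
Qed.

(** [p] is itself a derivative along the second family, [p = alpha * (phi_t - phi_x / t)], and
    [b + / t = - 2 / alpha]. *)
Lemma phi_transport (lam : R) (D : nat -> nat -> R -> R -> R) (t x : R) :
  0 < lam < 1/16 -> 0 < t < t1 lam ->
  2 * (D 1%nat 0%nat t x - / t * D 0%nat 1%nat t x)
  = - (outspeed lam t + / t) * pinv lam D t x.
Proof.
  intros Hl Ht. pose proof (horizon_factor_pos lam t Hl (proj2 Ht)) as Hg.
  unfold pinv, outspeed, alphaf, betaf. field. lra.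
Qed.

(** * Time weights *)

Definition hweight (lam dl t : R) : R := Rpower (t1 lam - t) dl.

Lemma is_derive_hweight (lam dl t : R) : t < t1 lam ->
  is_derive (hweight lam dl) t (- dl * hweight lam dl t / (t1 lam - t)).
Proof.
  intros Ht. unfold hweight, Rpower. auto_derive; [lra|].
  replace (t1 lam + - t) with (t1 lam - t) by ring. field. lra.
Qed.

(* [mweight] is the integrating factor of Gronwall's inequality: its logarithmic derivative is
   [- K - K2 * (t1 - t)^(dl - 1)]. *)
Definition mweight (lam dl K K2 t : R) : R := exp (- K * t + K2 / dl * hweight lam dl t).

Definition mrate (lam dl K K2 t : R) : R := - K - K2 * hweight lam dl t / (t1 lam - t).

Lemma is_derive_mweight (lam dl K K2 t : R) : 0 < dl -> t < t1 lam ->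
  is_derive (mweight lam dl K K2) t (mweight lam dl K K2 t * mrate lam dl K K2 t).
Proof.
  intros Hd Ht. unfold mweight, mrate.
  pose proof (is_derive_hweight lam dl t Ht) as Hh.
  auto_derive.
  - eexists; exact Hh.
  - replace (Derive (fun x => hweight lam dl x) t) with (- dl * hweight lam dl t / (t1 lam - t))
      by (symmetry; apply is_derive_unique, Hh).
    field. lra.
Qed.

Definition mhweight (lam dl K K2 t : R) : R := mweight lam dl K K2 t / hweight lam dl t.

(** Dividing by [hweight] adds [dl / (t1 - t)] to the logarithmic derivative: the growth that the
    damping of [p] has to cover. *)
Lemma is_derive_mhweight (lam dl K K2 t : R) : 0 < dl -> t < t1 lam ->
  is_derive (mhweight lam dl K K2) t
    (mhweight lam dl K K2 t * (mrate lam dl K K2 t + dl / (t1 lam - t))).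
Proof.
  intros Hd Ht. unfold mhweight.
  assert (Hp : hweight lam dl t <> 0) by (unfold hweight, Rpower; apply Rgt_not_eq, exp_pos).
  evar_last.
  - apply is_derive_div; [apply is_derive_mweight | apply is_derive_hweight |]; auto.
  - simpl. field. split; auto; lra.
Qed.

(** * Weighted energy density, its flux and their balance law *)

Definition energy (lam kappa dl K K2 : R) (D : nat -> nat -> R -> R -> R) (t x : R) : R :=
  mhweight lam dl K K2 t * (pinv lam D t x * pinv lam D t x)
  + mweight lam dl K K2 t * (rinv lam kappa D t x * rinv lam kappa D t x
                             + D 0%nat 0%nat t x * D 0%nat 0%nat t x).

Definition energy_t (lam kappa dl K K2 : R) (D : nat -> nat -> R -> R -> R) (t x : R) : R :=
  mhweight lam dl K K2 t * (mrate lam dl K K2 t + dl / (t1 lam - t))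
    * (pinv lam D t x * pinv lam D t x)
  + mhweight lam dl K K2 t * (2 * (pinv lam D t x * pinv_t lam D t x))
  + (mweight lam dl K K2 t * mrate lam dl K K2 t
      * (rinv lam kappa D t x * rinv lam kappa D t x + D 0%nat 0%nat t x * D 0%nat 0%nat t x)
    + mweight lam dl K K2 t
      * (2 * (rinv lam kappa D t x * rinv_t lam kappa D t x
              + D 0%nat 0%nat t x * D 1%nat 0%nat t x))).

(** Each part of the density is carried at the speed of its transport equation: [outspeed] for
    [p^2], and [- / t] for [r^2] and [phi^2]. *)
Definition flux (lam kappa dl K K2 : R) (D : nat -> nat -> R -> R -> R) (t x : R) : R :=
  outspeed lam t * (mhweight lam dl K K2 t * (pinv lam D t x * pinv lam D t x))
  - / t * (mweight lam dl K K2 t * (rinv lam kappa D t x * rinv lam kappa D t x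
                             + D 0%nat 0%nat t x * D 0%nat 0%nat t x)).

Definition flux_x (lam kappa dl K K2 : R) (D : nat -> nat -> R -> R -> R) (t x : R) : R :=
  outspeed lam t * (mhweight lam dl K K2 t * (2 * (pinv lam D t x * pinv_x lam D t x)))
  - / t * (mweight lam dl K K2 t * (2 * (rinv lam kappa D t x * rinv_x lam kappa D t x
                             + D 0%nat 0%nat t x * D 0%nat 1%nat t x))).

Lemma energy_balance (lam : R) (l : nat) (kappa dl K K2 S : R)
    (D : nat -> nat -> R -> R -> R) (t x : R) :
  0 < lam < 1/16 -> 0 < t < t1 lam -> solves_at lam l kappa S D t x ->
  let c := 6 - 2 * kappa in
  let w := t1 lam - t in
  let h := hweight lam dl t in
  let b1 := outspeed lam t in
  let V := potential lam l kappa t in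
  let p := pinv lam D t x in
  let r := rinv lam kappa D t x in
  let y := D 0%nat 0%nat t x in
  energy_t lam kappa dl K K2 D t x + flux_x lam kappa dl K K2 D t x
  = mweight lam dl K K2 t *
    ((- K - K2 * h / w + dl / w - c * b1) * (p ^ 2 / h)
    + p / h * (c * / t * (r + c * y) - 2 * V * y + 2 * S)
    + (- K - K2 * h / w) * (r ^ 2 + y ^ 2)
    + r * (c * / t * (p + r + c * y) - 2 * V * y + 2 * S)
    - (b1 + / t) * p * y).
Proof.
  intros Hl Ht HS c w h b1 V p r y.
  pose proof (pinv_transport lam l kappa S D t x Hl Ht HS) as Ep.
  pose proof (rinv_transport lam l kappa S D t x (proj1 Ht) HS) as Er.
  pose proof (phi_transport lam D t x Hl Ht) as Ey.
  assert (Hh : h <> 0) by (unfold h, hweight, Rpower; apply Rgt_not_eq, exp_pos).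
  unfold energy_t, flux_x, mhweight, mrate.
  fold c h w b1 V p r y in Ep, Er, Ey |- *.
  set (m := mweight lam dl K K2 t).
  (* Time and space derivatives are grouped along the characteristics, so that the three transport
     equations can be substituted and no second derivative remains. *)
  transitivity (m * ((- K - K2 * h / w + dl / w) * (p ^ 2 / h)
    + p / h * (2 * (pinv_t lam D t x + b1 * pinv_x lam D t x))
    + (- K - K2 * h / w) * (r ^ 2 + y ^ 2)
    + r * (2 * (rinv_t lam kappa D t x - / t * rinv_x lam kappa D t x))
    + y * (2 * (D 1%nat 0%nat t x - / t * D 0%nat 1%nat t x)))).
  - field. repeat split; auto; unfold w; lra.
  - rewrite Ep, Er, Ey. field. repeat split; auto; unfold w; lra.
Qed.

(** * Regularity of the energy density and of its flux *)

(** Factors depending on time alone are split off whole, which leaves their continuity as a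
    one-variable question. *)
Ltac strip_continuity :=
  repeat match goal with
  | |- continuous_on_strip _ _ (fun t _ => @?F t) => apply (continuous_on_strip_time _ _ F)
  | |- continuous_on_strip _ _ (fun t x => @?F t x + @?G t x) =>
      apply (continuous_on_strip_plus _ _ F G)
  | |- continuous_on_strip _ _ (fun t x => @?F t x - @?G t x) =>
      apply (continuous_on_strip_minus _ _ F G)
  | |- continuous_on_strip _ _ (fun t x => @?F t x * @?G t x) =>
      apply (continuous_on_strip_mult _ _ F G)
  end.

Lemma continuous_alphaf (lam t : R) : continuous (alphaf lam) t.
Proof. eapply continuous_is_derive, is_derive_alphaf. Qed.

Lemma continuous_betaf (lam t : R) : continuous (betaf lam) t.
Proof. eapply continuous_is_derive, is_derive_betaf. Qed.

Lemma continuous_Derive_alphaf (lam t : R) : continuous (Derive (alphaf lam)) t.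
Proof.
  apply (continuous_ext (fun s => -2 + 2 * s - 6 * lam * s ^ 2)).
  - intros s. symmetry. apply is_derive_unique. unfold alphaf, Gf. auto_derive; [exact I | field].
  - apply (ex_derive_continuous (V := R_NormedModule)). auto_derive. exact I.
Qed.

Lemma continuous_Derive_betaf (lam t : R) : continuous (Derive (betaf lam)) t.
Proof.
  apply (continuous_ext (fun s => 4 * lam * s - 1)).
  - intros s. symmetry. apply Derive_betaf.
  - apply (ex_derive_continuous (V := R_NormedModule)). auto_derive. exact I.
Qed.

Lemma continuous_plus_const (f : R -> R) (k t : R) :
  continuous f t -> continuous (fun s => f s + k) t.
Proof. intros Hf. apply (continuous_plus (V := R_NormedModule)); [exact Hf | apply continuous_const]. Qed.

Ltac coefficient_continuity :=
  lazymatch goal with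
  | |- context [Derive (alphaf _)] => apply continuous_Derive_alphaf
  | |- context [Derive (betaf _)] => apply continuous_Derive_betaf
  | |- context [alphaf] => apply continuous_alphaf
  | |- context [_ - 1] => apply (continuous_plus_const _ (- (1))), continuous_betaf
  | |- context [betaf] => apply continuous_plus_const, continuous_betaf
  | |- _ => apply continuous_const
  end.

Lemma continuous_on_strip_pinv (lam ti tf : R) (phi : R -> R -> R)
    (D : nat -> nat -> R -> R -> R) :
  smooth_strip ti tf phi D ->
  continuous_on_strip ti tf (pinv lam D) /\ continuous_on_strip ti tf (pinv_t lam D)
  /\ continuous_on_strip ti tf (pinv_x lam D).
Proof.
  intros HD.
  assert (HC : forall n m, continuous_on_strip ti tf (fun t x => D n m t x))
    by (intros n m; apply (continuous_on_strip_of_smooth ti tf phi D n m HD)).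
  unfold pinv, pinv_t, pinv_x. split; [|split]; strip_continuity;
    lazymatch goal with
    | |- continuous_on_strip _ _ _ => apply HC
    | |- _ => intros t Ht
    end;
    coefficient_continuity.
Qed.

Lemma continuous_on_strip_rinv (lam kappa ti tf : R) (phi : R -> R -> R)
    (D : nat -> nat -> R -> R -> R) :
  smooth_strip ti tf phi D ->
  continuous_on_strip ti tf (rinv lam kappa D) /\ continuous_on_strip ti tf (rinv_t lam kappa D)
  /\ continuous_on_strip ti tf (rinv_x lam kappa D).
Proof.
  intros HD.
  assert (HC : forall n m, continuous_on_strip ti tf (fun t x => D n m t x))
    by (intros n m; apply (continuous_on_strip_of_smooth ti tf phi D n m HD)).
  unfold rinv, rinv_t, rinv_x. split; [|split]; strip_continuity;
    lazymatch goal with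
    | |- continuous_on_strip _ _ _ => apply HC
    | |- _ => intros t Ht
    end;
    coefficient_continuity.
Qed.

Lemma continuous_mweight (lam dl K K2 t : R) :
  0 < dl -> t < t1 lam -> continuous (mweight lam dl K K2) t.
Proof. intros Hd Ht. eapply continuous_is_derive, is_derive_mweight; auto. Qed.

Lemma continuous_mhweight (lam dl K K2 t : R) :
  0 < dl -> t < t1 lam -> continuous (mhweight lam dl K K2) t.
Proof. intros Hd Ht. eapply continuous_is_derive, is_derive_mhweight; auto. Qed.

Lemma continuous_mrate (lam dl K K2 t : R) :
  t < t1 lam -> continuous (mrate lam dl K K2) t.
Proof.
  intros Ht. apply (ex_derive_continuous (V := R_NormedModule)). unfold mrate.
  auto_derive. split; [|split; [lra | exact I]].
  eexists. apply is_derive_hweight, Ht.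
Qed.

Lemma continuous_div_horizon (lam dl t : R) :
  t < t1 lam -> continuous (fun s => dl / (t1 lam - s)) t.
Proof.
  intros Ht. apply (ex_derive_continuous (V := R_NormedModule)). auto_derive. lra.
Qed.

Lemma continuous_on_strip_energy (lam kappa dl K K2 ti : R) (phi : R -> R -> R)
    (D : nat -> nat -> R -> R -> R) :
  0 < dl -> smooth_strip ti (t1 lam) phi D ->
  continuous_on_strip ti (t1 lam) (energy lam kappa dl K K2 D)
  /\ continuous_on_strip ti (t1 lam) (energy_t lam kappa dl K K2 D).
Proof.
  intros Hd HD.
  assert (HC : forall n m, continuous_on_strip ti (t1 lam) (fun t x => D n m t x))
    by (intros n m; apply (continuous_on_strip_of_smooth ti (t1 lam) phi D n m HD)).
  destruct (continuous_on_strip_pinv lam _ _ _ _ HD) as [Hp [Hpt Hpx]].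
  destruct (continuous_on_strip_rinv lam kappa _ _ _ _ HD) as [Hr [Hrt Hrx]].
  unfold energy, energy_t. split; strip_continuity;
    lazymatch goal with
    | |- continuous_on_strip _ _ _ => first [assumption | apply HC]
    | |- _ => intros t Ht
    end;
    lazymatch goal with
    | |- context [dl / _] =>
        apply (continuous_mult (K := R_AbsRing));
        [ apply continuous_mhweight; lra
        | apply (continuous_plus (V := R_NormedModule));
          [apply continuous_mrate; lra | apply continuous_div_horizon; lra] ]
    | |- context [mrate] =>
        apply (continuous_mult (K := R_AbsRing));
        [apply continuous_mweight; lra | apply continuous_mrate; lra]
    | |- context [mhweight] => apply continuous_mhweight; lra
    | |- context [mweight] => apply continuous_mweight; lra
    | |- _ => apply continuous_const
    end.
Qed.

Lemma is_derive_energy (lam kappa dl K K2 ti : R) (phi : R -> R -> R)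
    (D : nat -> nat -> R -> R -> R) (t x : R) :
  0 < dl -> smooth_strip ti (t1 lam) phi D -> ti < t < t1 lam ->
  is_derive (fun s => energy lam kappa dl K K2 D s x) t (energy_t lam kappa dl K K2 D t x).
Proof.
  intros Hd HD Ht.
  assert (HDt : forall n m, is_derive (fun s => D n m s x) t (D (S n) m t x))
    by (intros n m; apply (is_derive_time_of_smooth ti (t1 lam) phi D n m t x HD Ht)).
  assert (Hp : is_derive (fun s => pinv lam D s x) t (pinv_t lam D t x)).
  { unfold pinv, pinv_t.
    apply (is_derive_plus (V := R_NormedModule)).
    - apply (is_derive_mult (alphaf lam) (fun s => D 1%nat 0%nat s x));
        [apply is_derive_alphaf | apply HDt | apply Rmult_comm].
    - apply (is_derive_mult (fun s => betaf lam s + 1) (fun s => D 0%nat 1%nat s x));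
        [| apply HDt | apply Rmult_comm].
      rewrite Derive_betaf. rewrite <- (Rplus_0_r (4 * lam * t - 1)).
      apply (is_derive_plus (V := R_NormedModule)); [apply is_derive_betaf | apply (is_derive_const (V := R_NormedModule))]. }
  assert (Hr : is_derive (fun s => rinv lam kappa D s x) t (rinv_t lam kappa D t x)).
  { apply (is_derive_ext (fun s => pinv lam D s x
             - (2 * D 0%nat 1%nat s x + (6 - 2 * kappa) * D 0%nat 0%nat s x)));
      [intros s; unfold pinv, rinv; simpl; ring|].
    replace (rinv_t lam kappa D t x) with (pinv_t lam D t x
             - (2 * D 1%nat 1%nat t x + (6 - 2 * kappa) * D 1%nat 0%nat t x))
      by (unfold pinv_t, rinv_t; simpl; ring).
    apply (is_derive_minus (V := R_NormedModule)); [exact Hp|].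
    apply (is_derive_plus (V := R_NormedModule)); apply is_derive_scal, HDt. }
  pose proof (HDt 0%nat 0%nat) as Hy.
  assert (Hsq : forall u du, is_derive u t du -> is_derive (fun s => u s * u s) t (2 * (u t * du))).
  { intros u du Hu. replace (2 * (u t * du)) with (du * u t + u t * du) by ring.
    apply (is_derive_mult u u); auto. apply Rmult_comm. }
  unfold energy, energy_t.
  apply (is_derive_plus (V := R_NormedModule)).
  - apply (is_derive_mult (mhweight lam dl K K2) (fun s => pinv lam D s x * pinv lam D s x));
      [apply is_derive_mhweight; lra | apply (Hsq _ _ Hp) | apply Rmult_comm].
  - apply (is_derive_mult (mweight lam dl K K2) (fun s => rinv lam kappa D s x * rinv lam kappa D s x
        + D 0%nat 0%nat s x * D 0%nat 0%nat s x));
      [apply is_derive_mweight; lra | | apply Rmult_comm].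
    rewrite Rmult_plus_distr_l.
    apply (is_derive_plus (V := R_NormedModule)); [apply (Hsq _ _ Hr) | apply (Hsq _ _ Hy)].
Qed.

Lemma is_derive_flux (lam kappa dl K K2 ti : R) (phi : R -> R -> R)
    (D : nat -> nat -> R -> R -> R) (t x : R) :
  smooth_strip ti (t1 lam) phi D -> ti <= t < t1 lam ->
  is_derive (flux lam kappa dl K K2 D t) x (flux_x lam kappa dl K K2 D t x).
Proof.
  intros HD Ht.
  assert (HDx : forall n m, is_derive (D n m t) x (D n (S m) t x))
    by (intros n m; apply (HD n m t x Ht)).
  assert (Hp : is_derive (pinv lam D t) x (pinv_x lam D t x)).
  { unfold pinv, pinv_x.
    apply (is_derive_plus (V := R_NormedModule)); apply is_derive_scal, HDx. }
  assert (Hr : is_derive (rinv lam kappa D t) x (rinv_x lam kappa D t x)).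
  { unfold rinv, rinv_x.
    apply (is_derive_minus (V := R_NormedModule)); [|apply is_derive_scal, HDx].
    apply (is_derive_plus (V := R_NormedModule)); apply is_derive_scal, HDx. }
  pose proof (HDx 0%nat 0%nat) as Hy.
  assert (Hsq : forall u du, is_derive u x du -> is_derive (fun s => u s * u s) x (2 * (u x * du))).
  { intros u du Hu. replace (2 * (u x * du)) with (du * u x + u x * du) by ring.
    apply (is_derive_mult u u); auto. apply Rmult_comm. }
  unfold flux, flux_x.
  apply (is_derive_minus (V := R_NormedModule)); do 2 apply is_derive_scal.
  - apply (Hsq _ _ Hp).
  - rewrite Rmult_plus_distr_l.
    apply (is_derive_plus (V := R_NormedModule)); [apply (Hsq _ _ Hr) | apply (Hsq _ _ Hy)].
Qed.

Lemma continuous_flux_x (lam kappa dl K K2 ti : R) (phi : R -> R -> R)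
    (D : nat -> nat -> R -> R -> R) (t x : R) :
  smooth_strip ti (t1 lam) phi D -> ti <= t < t1 lam ->
  continuous (flux_x lam kappa dl K K2 D t) x.
Proof.
  intros HD Ht.
  destruct (continuous_on_strip_pinv lam _ _ _ _ HD) as [Hp [_ Hpx]].
  destruct (continuous_on_strip_rinv lam kappa _ _ _ _ HD) as [Hr [_ Hrx]].
  assert (HC : forall n m, continuous (D n m t) x).
  { intros n m. apply continuous_on_strip_slice with ti (t1 lam); auto.
    apply (continuous_on_strip_of_smooth ti (t1 lam) phi D n m HD). }
  unfold flux_x.
  apply (continuous_minus (V := R_NormedModule));
    do 3 (apply (continuous_mult (K := R_AbsRing)); [apply continuous_const|]).
  - apply (continuous_mult (K := R_AbsRing));
      [apply (continuous_on_strip_slice _ _ _ _ _ Hp Ht)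
      | apply (continuous_on_strip_slice _ _ _ _ _ Hpx Ht)].
  - apply (continuous_plus (V := R_NormedModule));
      apply (continuous_mult (K := R_AbsRing));
      [ apply (continuous_on_strip_slice _ _ _ _ _ Hr Ht)
      | apply (continuous_on_strip_slice _ _ _ _ _ Hrx Ht) | apply HC | apply HC].
Qed.

(** * Uniform bounds for the weights and for the energy production *)

Lemma hweight_pos (lam dl t : R) : 0 < hweight lam dl t.
Proof. apply exp_pos. Qed.

Lemma hweight_le (lam dl t : R) : 0 <= dl -> 0 <= t < t1 lam ->
  hweight lam dl t <= Rpower (t1 lam) dl.
Proof. intros Hd Ht. apply Rle_Rpower_l; lra. Qed.

(** Split [w = w^(1 - dl) * w^dl] with [w = t1 - t]; for [dl <= 1] the first factor is at most
    [t1^(1 - dl)]. *)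
Lemma horizon_le_hweight (lam dl t : R) : dl <= 1 -> 0 <= t < t1 lam ->
  t1 lam - t <= Rpower (t1 lam) (1 - dl) * hweight lam dl t.
Proof.
  intros Hd Ht. unfold hweight.
  rewrite <- (Rpower_1 (t1 lam - t)) at 1 by lra.
  replace 1 with ((1 - dl) + dl) at 1 by ring. rewrite Rpower_plus.
  apply Rmult_le_compat_r; [left; apply exp_pos|].
  apply Rle_Rpower_l; lra.
Qed.

(** The singular part [(t1 - t)^(dl - 1)] of the rate has the bounded primitive [- hweight / dl], so
    the integrating factor stays between positive constants up to [t1]. *)
Lemma mweight_bounds (lam dl K K2 t : R) :
  0 < dl -> 0 <= K -> 0 <= K2 -> 0 <= t < t1 lam ->
  exp (- K * t1 lam) <= mweight lam dl K K2 t <= exp (K2 / dl * Rpower (t1 lam) dl).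
Proof.
  intros Hd HK HK2 Ht. unfold mweight.
  assert (Hq : 0 <= K2 / dl) by (apply Rmult_le_pos; [|left; apply Rinv_0_lt_compat]; lra).
  pose proof (hweight_pos lam dl t). pose proof (hweight_le lam dl t (Rlt_le _ _ Hd) Ht).
  assert (Hexp : forall u v, u <= v -> exp u <= exp v)
    by (intros u v [Huv | ->]; [left; apply exp_increasing; auto | apply Rle_refl]).
  assert (0 <= K2 / dl * hweight lam dl t) by (apply Rmult_le_pos; lra).
  assert (K2 / dl * hweight lam dl t <= K2 / dl * Rpower (t1 lam) dl)
    by (apply Rmult_le_compat_l; lra).
  split; apply Hexp; nra.
Qed.

Lemma energy_production_bound (lam : R) (l : nat) (ti kappa : R) :
  0 < lam < 1/16 -> 0 < ti < t1 lam -> kappa < 3 ->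
  exists dl K K2 C, 0 < dl /\ 0 <= K /\ 0 <= K2 /\ 0 < C /\
    forall S D t x, ti <= t < t1 lam -> solves_at lam l kappa S D t x ->
      energy_t lam kappa dl K K2 D t x + flux_x lam kappa dl K K2 D t x <= C * S ^ 2.
Proof.
  intros Hl Hti Hk.
  destruct (t1_t2_spec lam Hl) as [H12 _].
  set (c := 6 - 2 * kappa). assert (Hc : 0 < c) by (unfold c; lra).
  (* [dl <= 1] serves [horizon_le_hweight]; [dl <= c / 2] leaves half of the damping for the cross
     terms. *)
  set (dl := Rmin 1 (c / 2)).
  assert (Hdl : 0 < dl) by (apply Rmin_glb_lt; lra).
  assert (Hdl1 : dl <= 1) by apply Rmin_l.
  assert (Hdlc : dl <= c / 2) by apply Rmin_r.
  (* [B] bounds [(t1 - t) * (outspeed + / t)], and [M] below bounds the regular coefficients, by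
     means of [/ t <= / ti]. *)
  set (B := (t1 lam + t2 lam) / (t2 lam - t1 lam) + t1 lam / ti).
  set (W := Rpower (t1 lam) (1 - dl)).
  set (Hm := Rpower (t1 lam) dl).
  set (Vb := Rabs (4 - kappa) + Rabs (8 - 6 * kappa + kappa ^ 2) + Rabs (ellf l)).
  set (M := c / ti + c ^ 2 / ti + 2 * Vb).
  assert (HW : 0 < W) by apply exp_pos.
  assert (HHm : 0 < Hm) by apply exp_pos.
  assert (HVb : 0 <= Vb).
  { unfold Vb. pose proof (Rabs_pos (4 - kappa)).
    pose proof (Rabs_pos (8 - 6 * kappa + kappa ^ 2)). pose proof (Rabs_pos (ellf l)). lra. }
  assert (Hcti : 0 < c / ti) by (apply Rdiv_lt_0_compat; lra).
  assert (Hc2 : 0 < c ^ 2) by (apply pow_lt; lra).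
  assert (Hc2ti : 0 < c ^ 2 / ti) by (apply Rdiv_lt_0_compat; lra).
  assert (HM : 0 <= M) by (unfold M; lra).
  assert (Hk3 : 0 <= 3 * W * M ^ 2 / c).
  { apply Rmult_le_pos; [|left; apply Rinv_0_lt_compat; lra].
    apply Rmult_le_pos; [lra | apply pow2_ge_0]. }
  assert (HMH : 0 <= M * Hm) by (apply Rmult_le_pos; lra).
  set (K := M * Hm + (3 * W * M ^ 2 / c + 2 * M + 1)).
  assert (HK : 0 <= K) by (unfold K; lra).
  assert (HK2 : 0 <= B ^ 2 / c)
    by (apply Rmult_le_pos; [apply pow2_ge_0 | left; apply Rinv_0_lt_compat; lra]).
  assert (HC0 : 0 < 12 * W / c + 1).
  { assert (0 < 12 * W / c) by (apply Rdiv_lt_0_compat; lra). lra. }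
  (* The exponential is the upper bound of [mweight], the common factor of the energy production. *)
  exists dl, K, (B ^ 2 / c), (exp (B ^ 2 / c / dl * Hm) * (12 * W / c + 1)).
  repeat split; auto.
  { apply Rmult_lt_0_compat; [apply exp_pos | auto]. }
  intros S D t x Ht HS.
  assert (Ht0 : 0 < t < t1 lam) by lra.
  assert (Ht1 : 0 <= t < t1 lam) by lra.
  rewrite (energy_balance lam l kappa dl K (B ^ 2 / c) S D t x Hl Ht0 HS).
  fold c.
  pose proof (outspeed_bounds lam t Hl Ht0) as Hos.
  pose proof (hweight_pos lam dl t) as Hhp.
  pose proof (hweight_le lam dl t (Rlt_le _ _ Hdl) Ht1) as Hhl.
  assert (Hit : 0 < / t) by (apply Rinv_0_lt_compat; lra).
  assert (Hiti : / t <= / ti) by (apply Rinv_le_contravar; lra).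
  assert (Hprod := energy_production_algebra c dl K B W Hm M (t1 lam - t) (hweight lam dl t)
    (outspeed lam t) (/ t) (potential lam l kappa t) (pinv lam D t x) (rinv lam kappa D t x)
    (D 0%nat 0%nat t x) S).
  destruct (mweight_bounds lam dl K (B ^ 2 / c) t Hdl HK HK2 Ht1) as [_ Hmw].
  rewrite (Rmult_assoc (exp _)).
  eapply Rle_trans.
  - apply Rmult_le_compat_l; [left; apply exp_pos|]. apply Hprod; auto; try lra.
    + apply horizon_le_hweight; auto.
    + rewrite Rmult_plus_distr_l. apply Rplus_le_compat; [lra|].
      apply Rmult_le_compat; lra.
    + rewrite Rabs_right by (apply Rle_ge, Rmult_le_pos; lra).
      apply Rle_trans with (c / ti); [apply Rmult_le_compat_l; lra | unfold M; lra].
    + pose proof (potential_bounded lam l kappa t Hl Ht0) as HV. fold Vb in HV.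
      apply Rabs_le_between in HV.
      assert (0 <= c ^ 2 * / t) by (apply Rmult_le_pos; lra).
      assert (c ^ 2 * / t <= c ^ 2 / ti) by (apply Rmult_le_compat_l; lra).
      apply Rabs_le. unfold M. lra.
    + unfold K. lra.
    + unfold K. lra.
  - apply Rmult_le_compat_r; [|exact Hmw].
    apply Rmult_le_pos; [lra | apply pow2_ge_0].
Qed.

(** * Comparison of the energy with its flux, the solution and the data *)

Lemma mhweight_pos (lam dl K K2 t : R) : 0 < mhweight lam dl K K2 t.
Proof. apply Rdiv_lt_0_compat; apply exp_pos. Qed.

Lemma energy_nonneg (lam kappa dl K K2 : R) (D : nat -> nat -> R -> R -> R) (t x : R) :
  0 <= energy lam kappa dl K K2 D t x.
Proof.
  unfold energy. apply Rplus_le_le_0_compat; apply Rmult_le_pos.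
  - left; apply mhweight_pos.
  - apply Rle_0_sqr.
  - left; apply exp_pos.
  - apply Rplus_le_le_0_compat; apply Rle_0_sqr.
Qed.

Lemma flux_le_energy (lam kappa dl K K2 L : R) (D : nat -> nat -> R -> R -> R) (t x : R) :
  0 <= outspeed lam t <= L -> 0 <= / t <= L ->
  Rabs (flux lam kappa dl K K2 D t x) <= L * energy lam kappa dl K K2 D t x.
Proof.
  intros Hb1 Hb2. unfold flux, energy.
  set (P := mhweight lam dl K K2 t * _).
  set (Q := mweight lam dl K K2 t * _).
  assert (HP : 0 <= P) by (apply Rmult_le_pos; [left; apply mhweight_pos | apply Rle_0_sqr]).
  assert (HQ : 0 <= Q).
  { apply Rmult_le_pos; [left; apply exp_pos|]. apply Rplus_le_le_0_compat; apply Rle_0_sqr. }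
  clearbody P Q. apply Rabs_le. split; nra.
Qed.

(** [L] may blow up as [T] tends to [t1]: it governs only the width of the cones, never the final
    constants. *)
Lemma characteristic_speed_bound (lam ti T : R) :
  0 < lam < 1/16 -> 0 < ti -> T < t1 lam ->
  exists L, 0 <= L /\ forall t, ti <= t <= T -> 0 <= outspeed lam t <= L /\ 0 <= / t <= L.
Proof.
  intros Hl Hti HT.
  destruct (t1_t2_spec lam Hl) as [H12 _].
  set (q := (t1 lam + t2 lam) / (t2 lam - t1 lam)).
  assert (Hq : 0 < q) by (apply Rdiv_lt_0_compat; lra).
  assert (HqT : 0 < q / (t1 lam - T)) by (apply Rdiv_lt_0_compat; lra).
  assert (Hi : 0 < / ti) by (apply Rinv_0_lt_compat; lra).
  exists (q / (t1 lam - T) + / ti). split; [lra|].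
  intros t Ht.
  assert (Ht0 : 0 < t < t1 lam) by lra.
  pose proof (outspeed_bounds lam t Hl Ht0) as Hos. fold q in Hos.
  assert (0 < / t) by (apply Rinv_0_lt_compat; lra).
  assert (/ t <= / ti) by (apply Rinv_le_contravar; lra).
  assert (0 <= outspeed lam t) by nra.
  assert (outspeed lam t <= q / (t1 lam - T)).
  { apply Rmult_le_reg_l with (t1 lam - T); [lra|].
    replace ((t1 lam - T) * (q / (t1 lam - T))) with q by (field; lra). nra. }
  lra.
Qed.

(** [p - r = 2 * phi_x + c * phi] recovers [phi_x], and the weights are bounded below uniformly in
    time. The left side is the integrand of the Sobolev inequality. *)
Lemma energy_coercive (lam kappa dl K K2 : R) :
  0 < dl -> 0 <= K -> 0 <= K2 ->
  exists C, 0 < C /\ forall D t x, 0 <= t < t1 lam ->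
    2 * D 0%nat 0%nat t x ^ 2 + D 0%nat 1%nat t x ^ 2 <= C * energy lam kappa dl K K2 D t x.
Proof.
  intros Hd HK HK2.
  set (c := 6 - 2 * kappa).
  set (m0 := exp (- K * t1 lam)). assert (Hm0 : 0 < m0) by apply exp_pos.
  set (Hm := Rpower (t1 lam) dl). assert (HHm : 0 < Hm) by apply exp_pos.
  assert (Hc2 : 0 <= c ^ 2) by apply pow2_ge_0.
  exists ((Hm + 3 + c ^ 2) / m0). split; [apply Rdiv_lt_0_compat; lra|].
  intros D t x Ht.
  destruct (mweight_bounds lam dl K K2 t Hd HK HK2 Ht) as [Hmw _]. fold m0 in Hmw.
  pose proof (hweight_pos lam dl t) as Hhp.
  pose proof (hweight_le lam dl t (Rlt_le _ _ Hd) Ht) as Hhl. fold Hm in Hhl.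
  set (p := pinv lam D t x). set (r := rinv lam kappa D t x). set (y := D 0%nat 0%nat t x).
  assert (E : D 0%nat 1%nat t x = (p - r - c * y) / 2)
    by (unfold p, r, y, c, pinv, rinv; field).
  rewrite E.
  assert (H1 : 2 * y ^ 2 + ((p - r - c * y) / 2) ^ 2 <= p ^ 2 + (3 + c ^ 2) * (r ^ 2 + y ^ 2)).
  { pose proof (pow2_ge_0 (p + r)). pose proof (pow2_ge_0 (p + c * y)).
    pose proof (pow2_ge_0 (r - c * y)). pose proof (pow2_ge_0 r). pose proof (pow2_ge_0 y).
    pose proof (pow2_ge_0 p).
    assert (0 <= c ^ 2 * r ^ 2) by (apply Rmult_le_pos; auto).
    assert (0 <= c ^ 2 * y ^ 2) by (apply Rmult_le_pos; auto). nra. }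
  assert (H2 : p ^ 2 <= Hm / m0 * (mhweight lam dl K K2 t * (p * p))).
  { assert (Hx : 1 <= Hm / m0 * mhweight lam dl K K2 t).
    { unfold mhweight.
      apply Rmult_le_reg_r with (m0 * hweight lam dl t); [apply Rmult_lt_0_compat; lra|].
      replace (Hm / m0 * (mweight lam dl K K2 t / hweight lam dl t) * (m0 * hweight lam dl t))
        with (Hm * mweight lam dl K K2 t) by (field; lra).
      rewrite Rmult_1_l, Rmult_comm. apply Rmult_le_compat; lra. }
    pose proof (Rle_0_sqr p) as Hpp. unfold Rsqr in Hpp.
    rewrite <- Rmult_assoc. nra. }
  assert (H3 : r ^ 2 + y ^ 2 <= / m0 * (mweight lam dl K K2 t * (r * r + y * y))).
  { assert (Hx : 1 <= / m0 * mweight lam dl K K2 t).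
    { apply Rmult_le_reg_l with m0; [lra|].
      rewrite <- Rmult_assoc, Rinv_r by lra. lra. }
    pose proof (Rle_0_sqr r) as Hrr. pose proof (Rle_0_sqr y) as Hyy. unfold Rsqr in Hrr, Hyy.
    rewrite <- Rmult_assoc. nra. }
  unfold energy. fold p r y.
  set (P := mhweight lam dl K K2 t * (p * p)) in *.
  set (Q := mweight lam dl K K2 t * (r * r + y * y)) in *.
  assert (HP : 0 <= P) by (apply Rmult_le_pos; [left; apply mhweight_pos | apply Rle_0_sqr]).
  assert (HQ : 0 <= Q).
  { apply Rmult_le_pos; [left; apply exp_pos|]. apply Rplus_le_le_0_compat; apply Rle_0_sqr. }
  assert (Hi : 0 < / m0) by (apply Rinv_0_lt_compat; lra).
  assert (0 <= / m0 * P) by (apply Rmult_le_pos; lra).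
  assert (0 <= / m0 * Q) by (apply Rmult_le_pos; lra).
  assert ((3 + c ^ 2) * (r ^ 2 + y ^ 2) <= (3 + c ^ 2) * (/ m0 * Q))
    by (apply Rmult_le_compat_l; lra).
  assert (0 <= (3 + c ^ 2) * (/ m0 * P)) by (apply Rmult_le_pos; lra).
  assert (0 <= Hm * (/ m0 * Q)) by (apply Rmult_le_pos; lra).
  unfold Rdiv in *. nra.
Qed.

Lemma energy_le_data (lam kappa dl K K2 t : R) :
  exists C, 0 < C /\ forall D x,
    energy lam kappa dl K K2 D t x
    <= C * (D 0%nat 0%nat t x ^ 2
            + (alphaf lam t * D 1%nat 0%nat t x + betaf lam t * D 0%nat 1%nat t x) ^ 2
            + D 0%nat 1%nat t x ^ 2).
Proof.
  set (c := 6 - 2 * kappa).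
  assert (HA := mhweight_pos lam dl K K2 t).
  assert (HB : 0 < mweight lam dl K K2 t) by apply exp_pos.
  assert (Hc2 : 0 <= c ^ 2) by apply pow2_ge_0.
  exists ((mhweight lam dl K K2 t + mweight lam dl K K2 t) * (4 + 3 * c ^ 2)).
  split; [apply Rmult_lt_0_compat; lra|].
  intros D x. unfold energy.
  set (psi := alphaf lam t * D 1%nat 0%nat t x + betaf lam t * D 0%nat 1%nat t x).
  set (u := D 0%nat 1%nat t x). set (y := D 0%nat 0%nat t x).
  replace (pinv lam D t x) with (psi + u) by (unfold pinv, psi, u; ring).
  replace (rinv lam kappa D t x) with (psi - u - c * y) by (unfold rinv, psi, u, y, c; ring).
  set (A := mhweight lam dl K K2 t) in *. set (m := mweight lam dl K K2 t) in *.
  set (N := y ^ 2 + psi ^ 2 + u ^ 2).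
  pose proof (pow2_ge_0 psi). pose proof (pow2_ge_0 u). pose proof (pow2_ge_0 y).
  assert (0 <= c ^ 2 * psi ^ 2) by (apply Rmult_le_pos; auto).
  assert (0 <= c ^ 2 * u ^ 2) by (apply Rmult_le_pos; auto).
  assert (0 <= c ^ 2 * y ^ 2) by (apply Rmult_le_pos; auto).
  assert (Hp : (psi + u) * (psi + u) <= (4 + 3 * c ^ 2) * N).
  { unfold N. pose proof (pow2_ge_0 (psi - u)). nra. }
  assert (Hr : (psi - u - c * y) * (psi - u - c * y) + y * y <= (4 + 3 * c ^ 2) * N).
  { unfold N. pose proof (pow2_ge_0 (psi + u)). pose proof (pow2_ge_0 (psi + c * y)).
    pose proof (pow2_ge_0 (u - c * y)). nra. }
  clearbody N A m psi u y.
  rewrite Rmult_assoc, (Rmult_plus_distr_r A m).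
  apply Rplus_le_compat; apply Rmult_le_compat_l; lra.
Qed.

(** * Integrals of the initial data and of the source *)

Lemma continuous_source_density (kappa ti : R) (mu0 : R -> R) (x : R) :
  (forall y, continuous mu0 y) ->
  continuous (fun y => exp (2 * (kappa - 3) * y) * (mu0 (ti * exp y)) ^ 2) x.
Proof.
  intros Hmu. apply (continuous_mult (K := R_AbsRing)).
  - apply (ex_derive_continuous (V := R_NormedModule)). auto_derive. exact I.
  - apply (continuous_pow2 (fun y => mu0 (ti * exp y))).
    apply (continuous_comp (fun y => ti * exp y) mu0); [|apply Hmu].
    apply (ex_derive_continuous (V := R_NormedModule)). auto_derive. exact I.
Qed.

Lemma continuous_initial_density (lam ti tf : R) (phi : R -> R -> R)
    (D : nat -> nat -> R -> R -> R) (x : R) :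
  ti < tf -> smooth_strip ti tf phi D ->
  continuous (fun y => D 0%nat 0%nat ti y ^ 2
    + (alphaf lam ti * D 1%nat 0%nat ti y + betaf lam ti * D 0%nat 1%nat ti y) ^ 2
    + D 0%nat 1%nat ti y ^ 2) x.
Proof.
  intros Htf HD.
  assert (Hti : ti <= ti < tf) by lra.
  assert (HDc : forall n m, continuous (D n m ti) x)
    by (intros n m; apply (continuous_is_derive _ _ (D n (S m) ti x)), (HD n m ti x Hti)).
  apply (continuous_plus (V := R_NormedModule)); [apply (continuous_plus (V := R_NormedModule))|].
  - apply continuous_pow2, HDc.
  - apply (continuous_pow2 (fun y => alphaf lam ti * D 1%nat 0%nat ti y
                                     + betaf lam ti * D 0%nat 1%nat ti y)).
    apply (continuous_plus (V := R_NormedModule));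
      (apply (continuous_mult (K := R_AbsRing)); [apply continuous_const | apply HDc]).
  - apply continuous_pow2, HDc.
Qed.

(* The source depends on [t * exp x] only up to an exponential factor, so that a translation in [x]
   brings its [L^2] norm at time [t] back to time [ti]. *)
Lemma source_RInt_le (lam kappa ti t a b J : R) (mu0 : R -> R) :
  0 < ti <= t -> t < t1 lam -> 0 <= kappa < 3 -> a <= b ->
  (forall x, continuous mu0 x) ->
  (forall u v, u <= v ->
     RInt (fun x => exp (2 * (kappa - 3) * x) * (mu0 (ti * exp x)) ^ 2) u v <= J) ->
  RInt (fun x => (8 * lam * exp ((kappa - 3) * x) * mu0 (t * exp x)) ^ 2) a b
    <= 64 * lam ^ 2 * exp (6 * ln (t1 lam / ti)) * J.
Proof.
  intros Hti Ht Hk Hab Hmu HJ.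
  set (j := fun x => exp (2 * (kappa - 3) * x) * (mu0 (ti * exp x)) ^ 2) in *.
  assert (Hj : forall x, continuous j x) by (intros x; apply continuous_source_density, Hmu).
  (* This is the translation: [t * exp x = ti * exp (x + s)]. *)
  set (s := ln (t / ti)).
  assert (Htt : 1 <= t / ti).
  { apply Rmult_le_reg_r with ti; [lra|]. unfold Rdiv. rewrite Rmult_assoc, Rinv_l; lra. }
  assert (Hs0 : 0 <= s).
  { unfold s. rewrite <- ln_1. apply ln_le; lra. }
  assert (Hs1 : s <= ln (t1 lam / ti)).
  { apply ln_le; [lra|]. apply Rmult_le_compat_r; [left; apply Rinv_0_lt_compat|]; lra. }
  assert (Hes : exp s = t / ti) by (apply exp_ln; lra).
  set (k := 64 * lam ^ 2 * exp (2 * (3 - kappa) * s)).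
  assert (E : forall x, (8 * lam * exp ((kappa - 3) * x) * mu0 (t * exp x)) ^ 2
      = scal k (j (1 * x + s))).
  { intros x. unfold j, k. change scal with Rmult.
    replace (ti * exp (1 * x + s)) with (t * exp x)
      by (rewrite Rmult_1_l, exp_plus, Hes; field; lra).
    replace (exp (2 * (kappa - 3) * (1 * x + s)))
      with (exp ((kappa - 3) * x) * exp ((kappa - 3) * x) * exp (- (2 * (3 - kappa) * s)))
      by (rewrite <- !exp_plus; f_equal; ring).
    replace (64 * lam ^ 2 * exp (2 * (3 - kappa) * s)
       * (exp ((kappa - 3) * x) * exp ((kappa - 3) * x) * exp (- (2 * (3 - kappa) * s))
           * mu0 (t * exp x) ^ 2))
      with (64 * lam ^ 2 * (exp ((kappa - 3) * x) * exp ((kappa - 3) * x)) * mu0 (t * exp x) ^ 2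
         * (exp (2 * (3 - kappa) * s) * exp (- (2 * (3 - kappa) * s)))) by ring.
    rewrite <- (exp_plus (2 * (3 - kappa) * s)), Rplus_opp_r, exp_0. ring. }
  rewrite (RInt_ext _ _ _ _ (fun x _ => E x)).
  assert (Hjs : ex_RInt (fun x => j (1 * x + s)) a b).
  { apply ex_RInt_everywhere_continuous. intros x.
    apply (continuous_comp (fun y => 1 * y + s) j); [|apply Hj].
    apply (ex_derive_continuous (V := R_NormedModule)). auto_derive. exact I. }
  rewrite (RInt_scal (V := R_CompleteNormedModule)) by exact Hjs.
  assert (E2 : RInt (fun x => j (1 * x + s)) a b = RInt j (1 * a + s) (1 * b + s)).
  { rewrite <- (RInt_comp_lin j 1 s a b) by (apply ex_RInt_everywhere_continuous, Hj).
    apply RInt_ext. intros x _. change scal with Rmult. symmetry. apply Rmult_1_l. }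
  rewrite E2. change (scal k ?u) with (k * u).
  assert (HJ0 : 0 <= J).
  { apply Rle_trans with (RInt j 0 0); [rewrite (RInt_point 0 j); apply Rle_refl | apply HJ; lra]. }
  assert (Hk0 : 0 <= k).
  { unfold k. apply Rmult_le_pos; [pose proof (pow2_ge_0 lam); lra | left; apply exp_pos]. }
  apply Rle_trans with (k * J).
  - apply Rmult_le_compat_l; auto. apply HJ. lra.
  - apply Rmult_le_compat_r; auto. unfold k.
    apply Rmult_le_compat_l; [pose proof (pow2_ge_0 lam); lra|].
    (* Here [0 <= kappa] and [0 <= s <= ln (t1 / ti)] make the constant independent of [t]. *)
    assert (Hexp : 2 * (3 - kappa) * s <= 6 * ln (t1 lam / ti)) by nra.
    destruct Hexp as [Hexp | ->]; [left; apply exp_increasing, Hexp | apply Rle_refl].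
Qed.

(** * The uniform bound *)

(** [E] and [J] are real bounds for the integrals over all bounded intervals, which is all that the
    cones require. [C1] and [C2] are fixed before [T] and [x0], hence uniform up to [t1]. *)
Lemma pointwise_bound (lam : R) (l : nat) (ti kappa : R) :
  0 < lam < 1/16 -> 0 < ti < t1 lam -> 0 <= kappa < 3 ->
  exists C1 C2 : R, 0 < C1 /\ 0 < C2 /\
  forall (mu0 : R -> R) (phi : R -> R -> R) (D : nat -> nat -> R -> R -> R) (E J : R),
    (forall x, continuous mu0 x) ->
    smooth_strip ti (t1 lam) phi D ->
    (forall t x, ti <= t < t1 lam ->
       solves_at lam l kappa (8 * lam * exp ((kappa - 3) * x) * mu0 (t * exp x)) D t x) ->
    (forall a b, a <= b ->
       RInt (fun x => D 0%nat 0%nat ti x ^ 2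
         + (alphaf lam ti * D 1%nat 0%nat ti x + betaf lam ti * D 0%nat 1%nat ti x) ^ 2
         + D 0%nat 1%nat ti x ^ 2) a b <= E) ->
    (forall a b, a <= b ->
       RInt (fun x => exp (2 * (kappa - 3) * x) * (mu0 (ti * exp x)) ^ 2) a b <= J) ->
    forall T x0, ti <= T < t1 lam -> D 0%nat 0%nat T x0 ^ 2 <= C1 * E + C2 * J.
Proof.
  intros Hl Hti Hk.
  destruct (energy_production_bound lam l ti kappa Hl Hti (proj2 Hk))
    as (dl & K & K2 & C & Hdl & HK & HK2 & HC & Hprod).
  destruct (energy_coercive lam kappa dl K K2 Hdl HK HK2) as [Cc [HCc Hcoer]].
  destruct (energy_le_data lam kappa dl K K2 ti) as [Cd [HCd Hdata]].
  set (Cs := 64 * lam ^ 2 * exp (6 * ln (t1 lam / ti))).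
  assert (HCs : 0 < Cs).
  { apply Rmult_lt_0_compat; [|apply exp_pos]. assert (0 < lam ^ 2) by (apply pow_lt; lra). lra. }
  (* [Cc] comes from Sobolev and coercivity, [Cd] from the data; [C * Cs] is the production rate per
     unit of [J], acting for a time below [t1]. *)
  exists (Cc * Cd), (Cc * (C * Cs * t1 lam)).
  split; [apply Rmult_lt_0_compat; lra|].
  split; [apply Rmult_lt_0_compat; [|apply Rmult_lt_0_compat; [apply Rmult_lt_0_compat|]]; lra|].
  intros mu0 phi D E J Hmu HD Hpde HE HJ T x0 HT.
  assert (HDc : forall n m t x, ti <= t < t1 lam -> continuous (D n m t) x).
  { intros n m t x Ht. apply continuous_on_strip_slice with ti (t1 lam); auto.
    apply (continuous_on_strip_of_smooth ti (t1 lam) phi D n m HD). }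
  assert (HJ0 : 0 <= J).
  { eapply Rle_trans; [|apply (HJ 0 0); lra]. rewrite (RInt_point 0). apply Rle_refl. }
  destruct (continuous_on_strip_energy lam kappa dl K K2 ti phi D Hdl HD) as [Hec Hetc].
  destruct (characteristic_speed_bound lam ti T Hl (proj1 Hti) (proj2 HT)) as [L [HL HLb]].
  assert (Hcs : forall t x, ti <= t < t1 lam -> continuous (energy lam kappa dl K K2 D t) x)
    by (intros; apply continuous_on_strip_slice with ti (t1 lam); auto).
  assert (Hloc := local_energy_estimate ti (t1 lam) T x0 L (C * (Cs * J))
    (energy lam kappa dl K K2 D) (energy_t lam kappa dl K K2 D)
    (flux lam kappa dl K K2 D) (flux_x lam kappa dl K K2 D)).
  assert (HLT : 0 <= L * (T - ti)) by (apply Rmult_le_pos; lra).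
  assert (HCsJ : 0 <= C * (Cs * J)) by (apply Rmult_le_pos; [|apply Rmult_le_pos]; lra).
  assert (Hen : RInt (energy lam kappa dl K K2 D T) (x0 - 1) (x0 + 1)
      <= RInt (energy lam kappa dl K K2 D ti) (x0 - 1 - L * (T - ti)) (x0 + 1 + L * (T - ti))
         + C * (Cs * J) * (T - ti)).
  { apply Hloc; auto.
    - intros t x Ht. apply (is_derive_energy lam kappa dl K K2 ti phi); auto.
    - intros t x Ht. apply (is_derive_flux lam kappa dl K K2 ti phi); auto.
    - intros t x Ht. apply (continuous_flux_x lam kappa dl K K2 ti phi); auto.
    - intros. apply energy_nonneg.
    - intros t x Ht. apply flux_le_energy; apply HLb, Ht.
    - intros t Ht.
      assert (Htf : ti <= t < t1 lam) by lra.
      assert (HLt : 0 <= L * (T - t)) by (apply Rmult_le_pos; lra).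
      assert (Hsc : forall x, continuous
        (fun x => (8 * lam * exp ((kappa - 3) * x) * mu0 (t * exp x)) ^ 2) x).
      { intros x.
        apply (continuous_pow2 (fun y => 8 * lam * exp ((kappa - 3) * y) * mu0 (t * exp y))).
        apply (continuous_mult (K := R_AbsRing)).
        - apply (ex_derive_continuous (V := R_NormedModule)). auto_derive. exact I.
        - apply (continuous_comp (fun y => t * exp y) mu0); [|apply Hmu].
          apply (ex_derive_continuous (V := R_NormedModule)). auto_derive. exact I. }
      eapply Rle_trans.
      + apply (RInt_le _ (fun x => C * (8 * lam * exp ((kappa - 3) * x) * mu0 (t * exp x)) ^ 2)).
        * lra.
        * apply ex_RInt_everywhere_continuous. intros x.
          apply (continuous_plus (V := R_NormedModule)).
          -- apply continuous_on_strip_slice with ti (t1 lam); auto.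
          -- apply (continuous_flux_x lam kappa dl K K2 ti phi); auto.
        * apply ex_RInt_everywhere_continuous. intros x.
          apply (continuous_mult (K := R_AbsRing)); [apply continuous_const | apply Hsc].
        * intros x _. apply Hprod; auto.
      + rewrite (RInt_scal (V := R_CompleteNormedModule))
          by (apply ex_RInt_everywhere_continuous, Hsc).
        apply Rmult_le_compat_l; [lra|].
        apply source_RInt_le; auto; lra. }
  assert (Hinit : RInt (energy lam kappa dl K K2 D ti) (x0 - 1 - L * (T - ti)) (x0 + 1 + L * (T - ti))
      <= Cd * E).
  { set (dat := fun x => D 0%nat 0%nat ti x ^ 2
         + (alphaf lam ti * D 1%nat 0%nat ti x + betaf lam ti * D 0%nat 1%nat ti x) ^ 2
         + D 0%nat 1%nat ti x ^ 2) in *.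
    assert (Hdc : forall x, continuous dat x)
      by (intros x; apply (continuous_initial_density lam ti (t1 lam) phi); auto; lra).
    eapply Rle_trans.
    - apply (RInt_le _ (fun x => Cd * dat x)).
      + lra.
      + apply ex_RInt_everywhere_continuous. intros x. apply Hcs. lra.
      + apply ex_RInt_everywhere_continuous. intros x.
        apply (continuous_mult (K := R_AbsRing)); [apply continuous_const | apply Hdc].
      + intros x _. apply Hdata.
    - rewrite (RInt_scal (V := R_CompleteNormedModule))
        by (apply ex_RInt_everywhere_continuous, Hdc).
      apply Rmult_le_compat_l; [lra|]. apply HE. lra. }
  assert (Hsob : D 0%nat 0%nat T x0 ^ 2
      <= Cc * RInt (energy lam kappa dl K K2 D T) (x0 - 1) (x0 + 1)).
  { eapply Rle_trans.
    - apply (sobolev_unit_interval (D 0%nat 0%nat T) (D 0%nat 1%nat T)).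
      + intros y. apply (HD 0%nat 0%nat T y HT).
      + intros y. apply HDc, HT.
    - assert (Hfin : ex_RInt (energy lam kappa dl K K2 D T) (x0 - 1) (x0 + 1))
        by (apply ex_RInt_everywhere_continuous; intros x; apply Hcs, HT).
      assert (Esc : RInt (fun y => Cc * energy lam kappa dl K K2 D T y) (x0 - 1) (x0 + 1)
          = Cc * RInt (energy lam kappa dl K K2 D T) (x0 - 1) (x0 + 1))
        by (apply (RInt_scal (V := R_CompleteNormedModule)), Hfin).
      rewrite <- Esc.
      apply RInt_le.
      + lra.
      + apply ex_RInt_everywhere_continuous. intros x.
        apply (continuous_plus (V := R_NormedModule)).
        * apply (continuous_mult (K := R_AbsRing)); [apply continuous_const|].
          apply continuous_pow2, HDc, HT.
        * apply continuous_pow2, HDc, HT.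
      + apply (ex_RInt_scal (V := R_NormedModule)), Hfin.
      + intros x _. apply Hcoer. lra. }
  assert (Hlast : C * (Cs * J) * (T - ti) <= C * (Cs * J) * t1 lam)
    by (apply Rmult_le_compat_l; lra).
  eapply Rle_trans; [exact Hsob|].
  replace (Cc * Cd * E + Cc * (C * Cs * t1 lam) * J)
    with (Cc * (Cd * E + C * (Cs * J) * t1 lam)) by ring.
  apply Rmult_le_compat_l; lra.
Qed.

(** If one of [a], [b] is infinite, so is the right side, because the coefficients are positive and
    the other term is nonnegative; only finite values need an estimate. *)
Lemma Rbar_le_linear_combination (y C1 C2 : R) (a b : Rbar) :
  0 < C1 -> 0 < C2 -> Rbar_le 0 a -> Rbar_le 0 b ->
  (forall E J : R, a = Finite E -> b = Finite J -> y <= C1 * E + C2 * J) ->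
  Rbar_le y (Rbar_plus (Rbar_mult C1 a) (Rbar_mult C2 b)).
Proof.
  intros H1 H2 Ha Hb H.
  destruct a as [a| |], b as [b| |]; simpl in Ha, Hb; try contradiction.
  - apply (H a b); reflexivity.
  - replace (Rbar_mult C2 p_infty) with p_infty; [exact I|].
    symmetry. apply is_Rbar_mult_unique, is_Rbar_mult_sym, is_Rbar_mult_p_infty_pos, H2.
  - replace (Rbar_mult C1 p_infty) with p_infty; [exact I|].
    symmetry. apply is_Rbar_mult_unique, is_Rbar_mult_sym, is_Rbar_mult_p_infty_pos, H1.
  - replace (Rbar_mult C1 p_infty) with p_infty.
    replace (Rbar_mult C2 p_infty) with p_infty; [exact I|].
    + symmetry. apply is_Rbar_mult_unique, is_Rbar_mult_sym, is_Rbar_mult_p_infty_pos, H2.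
    + symmetry. apply is_Rbar_mult_unique, is_Rbar_mult_sym, is_Rbar_mult_p_infty_pos, H1.
Qed.

Theorem theorem3 (lam : R) (l : nat) (ti kappa : R)
  (Hlam : 0 < lam < 1/16) (Hl : (2 <= l)%nat)
  (Hti : 0 < ti < t1 lam) (Hkappa : 0 <= kappa < kappa1 lam) :
  exists C1 C2 : R, 0 < C1 /\ 0 < C2 /\
  forall (f g mu0 : R -> R) (phi : R -> R -> R) (D : nat -> nat -> R -> R -> R),
    C0inf f -> C0inf g -> C0inf mu0 ->
    smooth_strip ti (t1 lam) phi D ->
    (forall t x, ti <= t < t1 lam ->
       alphaf lam t * D 2%nat 0%nat t x
       + 2 * betaf lam t * D 1%nat 1%nat t x
       + gammaf lam t * D 0%nat 2%nat t x
       + (Derive (alphaf lam) t + (6 - 2 * kappa) * betaf lam t) * D 1%nat 0%nat t x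
       + (Derive (betaf lam) t + (6 - 2 * kappa) * gammaf lam t) * D 0%nat 1%nat t x
       + ((4 - kappa) * Derive (betaf lam) t
          + (8 - 6 * kappa + kappa ^ 2) * gammaf lam t - ellf l) * phi t x
       = 8 * lam * exp ((kappa - 3) * x) * mu0 (t * exp x)) ->
    (forall x, phi ti x = f x) ->
    (forall x, D 1%nat 0%nat ti x = g x) ->
    forall t x, ti <= t < t1 lam ->
      Rbar_le (Finite ((Rabs (phi t x)) ^ 2))
        (Rbar_plus (Rbar_mult (Finite C1) (E1_0 lam ti D))
                   (Rbar_mult (Finite C2) (J_kappa kappa ti mu0))).
Proof.
  assert (Hk : 0 <= kappa < 3) by (pose proof (kappa1_lt_3 lam Hlam); lra).
  destruct (pointwise_bound lam l ti kappa Hlam Hti Hk) as [C1 [C2 [HC1 [HC2 Hbound]]]].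
  exists C1, C2. split; [exact HC1|]. split; [exact HC2|].
  intros f g mu0 phi D _ _ Hmu HD Hpde _ _ t x Ht.
  assert (Hmuc : forall y, continuous mu0 y).
  { intros y. apply (ex_derive_continuous (V := R_NormedModule)). exact (proj1 Hmu 1%nat y). }
  set (dat := fun y => D 0%nat 0%nat ti y ^ 2
     + (alphaf lam ti * D 1%nat 0%nat ti y + betaf lam ti * D 0%nat 1%nat ti y) ^ 2
     + D 0%nat 1%nat ti y ^ 2).
  assert (Hdat : forall y, continuous dat y)
    by (intros y; apply (continuous_initial_density lam ti (t1 lam) phi); auto; lra).
  assert (Hdat0 : forall y, 0 <= dat y).
  { intros y. unfold dat. repeat apply Rplus_le_le_0_compat; apply pow2_ge_0. }
  set (j := fun y => exp (2 * (kappa - 3) * y) * (mu0 (ti * exp y)) ^ 2).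
  assert (Hj : forall y, continuous j y) by (intros y; apply continuous_source_density, Hmuc).
  assert (Hj0 : forall y, 0 <= j y).
  { intros y. unfold j. apply Rmult_le_pos; [left; apply exp_pos | apply pow2_ge_0]. }
  change (E1_0 lam ti D) with (int_R dat).
  change (J_kappa kappa ti mu0) with (int_R j).
  apply Rbar_le_linear_combination; auto; try (apply int_R_nonneg; auto).
  intros E J HE HJ.
  rewrite pow2_abs, <- (proj1 (HD 0%nat 0%nat t x Ht)).
  apply (Hbound mu0 phi D E J); auto.
  (* On the strip [phi] is [D 0 0], which turns the equation into [solves_at]. *)
  - intros s y Hs. unfold solves_at, potential.
    rewrite (proj1 (HD 0%nat 0%nat s y Hs)). apply Hpde, Hs.
  - intros a b Hab. pose proof (RInt_le_int_R dat a b Hdat Hdat0 Hab) as H.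
    rewrite HE in H. exact H.
  - intros a b Hab. pose proof (RInt_le_int_R j a b Hj Hj0 Hab) as H.
    rewrite HJ in H. exact H.
Qed.
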